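(* Let $n\ge 4$, let $G$ be the split simply connected group of type $D_n$ over $k$, $V$ its $2n$-dimensional irreducible representation with highest weight $\omega_1$, $b$ a nonzero $G$-invariant symmetric bilinear form on $V$, and $\Gamma_V$ the associated geometry of subspaces of $V$. Let $e_1,\dots,e_n,f_1,\dots,f_n$ be the basis of weight vectors of $V$ described in the context, and let $s\in GL(V)$ be the linear map that fixes $e_i$ and $f_i$ for $1\le i<n$ and interchanges $e_n$ and $f_n$. Let $\phi$ be the automorphism of $SO(b)$ given by $\phi(g)=sgs^{-1}$, and denote also by $\phi$ its unique lift to an automorphism of $G$. For each subspace $X$ of $V$ put $\psi(X):=sX$. Then the restriction of $\psi$ to $\Gamma_V$ is the automorphism of the geometry $\Gamma_V$ induced by the automorphism $\phi$ of $G$.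
   Context: $k$ is a field of characteristic zero. The simple roots $\Delta=\{\alpha_1,\dots,\alpha_n\}$ of $D_n$ are numbered as in Bourbaki: a chain $\alpha_1-\cdots-\alpha_{n-2}$ with both $\alpha_{n-1}$ and $\alpha_n$ joined to $\alpha_{n-2}$. $T\subset B$ are the standard split maximal torus and Borel subgroup, $\mathfrak X_\rho$ is the root subgroup of a root $\rho$, and $P_\delta$ ($\delta\in\Delta$) is the maximal parabolic generated by $B$ and the $\mathfrak X_{-\alpha}$, $\alpha\in\Delta\setminus\{\delta\}$. $SO(b)$ is the subgroup of $SL(V)$ preserving $b$; the representation of $G$ on $V$ is a central isogeny $G\to SO(b)$. The basis: for $1\le i\le n$ put $\varepsilon_i:=\omega_1-\sum_{j=1}^{i-1}\alpha_j$. The weights of $V$ are $\pm\varepsilon_1,\dots,\pm\varepsilon_n$, each of multiplicity one. $e_i$ is a nonzero vector of weight $\varepsilon_i$ and $f_i$ a nonzero vector of weight $-\varepsilon_i$, scaled so that $b(e_i,f_j)=\delta_{ij}$ (and $b(e_i,e_j)=b(f_i,f_j)=0$ for all $i,j$). Geometry: let $v^+\in V$ be a highest weight vector, $V_{\alpha_1}=kv^+$. For $\delta\ne\alpha_1$, let $L_\delta$ be the subgroup generated by the $\mathfrak X_\rho$ for roots $\rho$ that are combinations of simple roots in the connected component of $\alpha_1$ in the diagram with $\delta$ removed, and let $V_\delta$ be the span of the $L_\delta$-orbit of $v^+$. The objects of $\Gamma_V$ are the subspaces $gV_\delta$ ($g\in G(k)$, $\delta\in\Delta$); $gV_\delta$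 has type $\delta$, its stabilizer is $gP_\delta g^{-1}$, and sending an object to its stabilizer is a bijection onto the maximal proper parabolic subgroups of $G$. Two objects are incident if the intersection of their stabilizers contains a parabolic subgroup. The automorphism of $\Gamma_V$ induced by $\phi$ sends the object with stabilizer $P$ to the object with stabilizer $\phi(P)$. *)

(* Defs.v *)
From HB Require Import structures.
From mathcomp Require Import all_boot all_order all_algebra.

Set Implicit Arguments.
Unset Strict Implicit.
Unset Printing Implicit Defensive.

Import GRing.Theory.
Local Open Scope ring_scope.

(** * Affine algebraic groups over a field, as functors of points *)

(* Commutative k-algebras are given by their structure morphism, so that k
   itself and its field extensions are directly k-algebras.  Any commutative
   ring can classically be made a comUnitRingType, so this is no restriction;
   it gives access to [GRing.unit] and to integer powers of units. *)
Record kalg (k : fieldType) := KAlg {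
  kalg_ring :> comUnitRingType;
  kalg_str : {rmorphism k -> kalg_ring} }.

Record khom (k : fieldType) (A B : kalg k) := KHom {
  khom_fun :> {rmorphism A -> B};
  khom_str : forall c : k, khom_fun (kalg_str A c) = kalg_str B c }.

Definition base (k : fieldType) : kalg k := KAlg (idfun : {rmorphism k -> k}).

Record gfunctor (k : fieldType) := GFunctor {
  pts :> kalg k -> groupType;
  gmap : forall A B : kalg k, khom A B -> pts A -> pts B;
  gmapM : forall (A B : kalg k) (f : khom A B) (g h : pts A),
    gmap f (g * h)%g = (gmap f g * gmap f h)%g;
  gmap_id : forall (A : kalg k) (f : khom A A) (g : pts A),
    (forall a, f a = a) -> gmap f g = g;
  gmap_comp : forall (A B C : kalg k) (f : khom A B) (f' : khom B C)
      (f'' : khom A C) (g : pts A),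
    (forall a, f'' a = f' (f a)) -> gmap f'' g = gmap f' (gmap f g) }.

Arguments gmap {k} _ {A B} _ _.

Definition fin_gen_alg (k : fieldType) (R : kalg k) : Prop :=
  exists gens : seq R, forall S : R -> Prop,
    (forall c, S (kalg_str R c)) -> (forall r, r \in gens -> S r) ->
    (forall r r', S r -> S r' -> S (r + r')) ->
    (forall r r', S r -> S r' -> S (r * r')) -> forall r, S r.

(* G is represented by the finitely generated algebra R = k[G], with universal
   point u. *)
Definition affine_algebraic (k : fieldType) (G : gfunctor k) : Prop :=
  exists (R : kalg k) (u : G R), fin_gen_alg R /\
    forall (A : kalg k) (g : G A),
      (exists f : khom R A, gmap G f u = g) /\
      (forall f f' : khom R A, gmap G f u = gmap G f' u -> f =1 f').

(* Homomorphisms of affine group schemes are the natural transformations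
   (Yoneda); the same remark applies to representations and to regular
   functions below. *)
Record ghom (k : fieldType) (G H : gfunctor k) := GHom {
  ghom_fun :> forall A : kalg k, G A -> H A;
  ghomM : forall (A : kalg k) (g h : G A),
    ghom_fun (g * h)%g = (ghom_fun g * ghom_fun h)%g;
  ghom_nat : forall (A B : kalg k) (f : khom A B) (g : G A),
    ghom_fun (gmap G f g) = gmap H f (ghom_fun g) }.

Definition gautomorphism (k : fieldType) (G : gfunctor k) (phi : ghom G G) :
    Prop :=
  forall A : kalg k, bijective (@ghom_fun _ _ _ phi A).

Definition regular_fun (k : fieldType) (G : gfunctor k)
    (f : forall A : kalg k, G A -> A) : Prop :=
  forall (A B : kalg k) (h : khom A B) (g : G A), f B (gmap G h g) = h (f A g).

Definition subfunctor (k : fieldType) (G : gfunctor k) :=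
  forall A : kalg k, G A -> Prop.

Definition sub_incl (k : fieldType) (G : gfunctor k) (P Q : subfunctor G) :
    Prop :=
  forall (A : kalg k) (g : G A), P A g -> Q A g.

Definition sub_eq (k : fieldType) (G : gfunctor k) (P Q : subfunctor G) :
    Prop :=
  forall (A : kalg k) (g : G A), P A g <-> Q A g.

Definition sub_image (k : fieldType) (G : gfunctor k) (phi : ghom G G)
    (P : subfunctor G) : subfunctor G :=
  fun A g => exists2 h : G A, P A h & g = phi A h.

Definition is_subgroup (gT : groupType) (S : gT -> Prop) : Prop :=
  [/\ S 1%g, forall g h, S g -> S h -> S (g * h)%g
    & forall g, S g -> S (g^-1)%g].

Definition closed_subgroup (k : fieldType) (G : gfunctor k)
    (S : subfunctor G) : Prop :=
  (exists I : (forall A : kalg k, G A -> A) -> Prop,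
     (forall f, I f -> regular_fun f) /\
     forall (A : kalg k) (g : G A), S A g <-> forall f, I f -> f A g = 0) /\
  (forall A : kalg k, is_subgroup (@S A)).

(* The smallest closed subgroup containing E. *)
Definition generated (k : fieldType) (G : gfunctor k) (E : subfunctor G) :
    subfunctor G :=
  fun A g => forall S : subfunctor G, closed_subgroup S -> sub_incl E S -> S A g.

(** * Borel and parabolic subgroups *)

(* Zariski-closed subsets of G(K): the coordinate ring of G_K is
   K tensor k[G], so its elements are the K-combinations of elements of k[G]. *)
Definition Kregular (k : fieldType) (G : gfunctor k) (K : kalg k)
    (F : G K -> K) : Prop :=
  exists (d : nat) (c : 'I_d -> K) (f : 'I_d -> forall A : kalg k, G A -> A),
    (forall i, regular_fun (f i)) /\
    forall g, F g = \sum_(i < d) c i * f i K g.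

Definition Kclosed_subgroup (k : fieldType) (G : gfunctor k) (K : kalg k)
    (Z : G K -> Prop) : Prop :=
  (exists I : (G K -> K) -> Prop,
     (forall F, I F -> Kregular F) /\
     forall g, Z g <-> forall F, I F -> F g = 0) /\
  is_subgroup Z.

(* A closed subgroup is connected iff it has no proper closed subgroup of
   finite index. *)
Definition Kconnected (k : fieldType) (G : gfunctor k) (K : kalg k)
    (Z : G K -> Prop) : Prop :=
  forall Z' : G K -> Prop, Kclosed_subgroup Z' -> (forall g, Z' g -> Z g) ->
    (exists r : seq (G K), forall g, Z g -> exists2 h, h \in r & Z' (h^-1 * g)%g) ->
    forall g, Z g -> Z' g.

Fixpoint derived (gT : groupType) (Z : gT -> Prop) (i : nat) : gT -> Prop :=
  if i is j.+1 then
    fun g => forall S : gT -> Prop, is_subgroup S ->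
      (forall x y, derived Z j x -> derived Z j y ->
         S (x * y * x^-1 * y^-1)%g) -> S g
  else Z.

Definition abs_solvable (gT : groupType) (Z : gT -> Prop) : Prop :=
  exists d : nat, forall g, derived Z d g -> g = 1%g.

Definition Borel (k : fieldType) (G : gfunctor k) (K : kalg k)
    (Z : G K -> Prop) : Prop :=
  let P Z := [/\ Kclosed_subgroup Z, Kconnected Z & abs_solvable Z] in
  P Z /\ forall Z' : G K -> Prop,
    P Z' -> (forall g, Z g -> Z' g) -> forall g, Z' g -> Z g.

(* A subgroup of G over k is parabolic iff it contains a Borel subgroup after
   extension to an algebraically closed field. *)
Definition parabolic (k : fieldType) (G : gfunctor k) (P : subfunctor G) :
    Prop :=
  closed_subgroup P /\
  exists (K : closedFieldType) (iota : {rmorphism k -> K}),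
  let K' : kalg k := KAlg iota in
  exists2 Z : G K' -> Prop, Borel Z & forall g, Z g -> P K' g.

(** * The root system D_n, in Bourbaki's coordinates *)

Definition dot (n : nat) (r s : 'rV[int]_n) : int := \sum_(j < n) r 0 j * s 0 j.

Definition unit_vec (n i : nat) : 'rV[int]_n := \row_(j < n) (j == i :> nat)%:R.

(* All indices are shifted by one: the simple root [simple_root i] is the
   Bourbaki root with number i.+1. *)
Definition simple_root (n : nat) (i : 'I_n) : 'rV[int]_n :=
  if (i.+1 < n)%N then unit_vec n i - unit_vec n i.+1
  else unit_vec n n.-2 + unit_vec n n.-1.

(* The integer vectors of square length 2 are the +-u_i +- u_j with i != j.
   As all roots have square length 2, the pairing of a weight w with the
   coroot of r is [dot w r]. *)
Definition is_root (n : nat) (r : 'rV[int]_n) : Prop := dot r r = 2.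

Definition is_pos_root (n : nat) (r : 'rV[int]_n) : Prop :=
  is_root r /\ exists c : 'I_n -> nat, r = \sum_(i < n) simple_root i *+ c i.

Definition omega1 (n : nat) : 'rV[int]_n := unit_vec n 0.

Definition eps (n : nat) (i : 'I_n) : 'rV[int]_n :=
  omega1 n - \sum_(j < n | (j < i)%N) simple_root j.

(* The connected component of the first simple root in the Dynkin diagram
   with d removed (used only when d is not the first simple root). *)
Definition in_component (n : nat) (d j : 'I_n) : Prop :=
  exists2 i0 : 'I_n, i0 = 0%N :> nat &
    connect [rel i j : 'I_n | [&& i != d, j != d, i != j
                                & dot (simple_root i) (simple_root j) != 0]]
            i0 j.

Definition is_component_root (n : nat) (d : 'I_n) (r : 'rV[int]_n) : Prop :=
  is_root r /\ exists c : 'I_n -> int,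
    (forall j, c j != 0 -> in_component d j) /\
    r = \sum_(j < n) simple_root j *~ c j.

(** * The split simply connected group of type D_n *)

(* A family x of maps u |-> x_r(u), one for each root r; the values of the
   family at vectors r that are not roots are irrelevant. *)
Definition root_maps (k : fieldType) (n : nat) (G : gfunctor k) :=
  forall (r : 'rV[int]_n) (A : kalg k), A -> G A.

(* w_r(t) and the coroot h_r(t), for t a unit. *)
Definition root_w (k : fieldType) (n : nat) (G : gfunctor k)
    (x : root_maps n G) (r : 'rV[int]_n) (A : kalg k) (t : A) : G A :=
  (x r A t * x (- r) A (- t^-1) * x r A t)%g.

Definition coroot (k : fieldType) (n : nat) (G : gfunctor k)
    (x : root_maps n G) (r : 'rV[int]_n) (A : kalg k) (t : A) : G A :=
  (root_w x r t * (root_w x r (1 : A))^-1)%g.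

(* An affine algebraic group G over k with root subgroups x_r : G_a -> G
   indexed by the roots of D_n, which generate G and satisfy the
   Chevalley-Steinberg relations; the torus T generated by the coroots is the
   direct product of the images of the simple coroots, i.e. the simple coroots
   form a basis of the cocharacters of T, which says that G is simply
   connected.  In characteristic zero these properties determine G. *)
Record split_simply_connected_D (k : fieldType) (n : nat) (G : gfunctor k)
    (x : root_maps n G) : Prop := SplitSCD {
  ssc_affine : affine_algebraic G;
  ssc_nat : forall r, is_root r -> forall (A B : kalg k) (f : khom A B) (u : A),
    gmap G f (x r A u) = x r B (f u);
  ssc_add : forall r, is_root r -> forall (A : kalg k) (u v : A),
    x r A (u + v) = (x r A u * x r A v)%g;
  ssc_inj : forall r, is_root r -> forall A : kalg k, injective (x r A);
  ssc_comm : forall r s, is_root r -> is_root s -> is_root (r + s) ->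
    exists c : k, forall (A : kalg k) (u v : A),
      (x r A u * x s A v * (x r A u)^-1 * (x s A v)^-1)%g
      = x (r + s) A (kalg_str A c * u * v);
  ssc_comm1 : forall r s, is_root r -> is_root s -> ~ is_root (r + s) ->
    r + s != 0 -> forall (A : kalg k) (u v : A),
      (x r A u * x s A v = x s A v * x r A u)%g;
  ssc_corootM : forall r, is_root r -> forall (A : kalg k) (t u : A),
    t \is a GRing.unit -> u \is a GRing.unit ->
    coroot x r (t * u) = (coroot x r t * coroot x r u)%g;
  ssc_corootJ : forall r s, is_root r -> is_root s ->
    forall (A : kalg k) (t u : A), t \is a GRing.unit ->
      (coroot x r t * x s A u * (coroot x r t)^-1)%g
      = x s A (t ^ dot s r * u);
  ssc_gen : forall (A : kalg k) (g : G A),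
    generated (fun B h => exists r, is_root r /\ exists u : B, h = x r B u) g;
  ssc_torus : forall (A : kalg k) (t : 'I_n -> A),
    (forall i, t i \is a GRing.unit) ->
    (\prod_(i < n) coroot x (simple_root i) (t i))%g = 1%g ->
    forall i, t i = 1 }.

(** * Representations *)

Record rep (k : fieldType) (G : gfunctor k) (m : nat) := Rep {
  rep_mx :> forall A : kalg k, G A -> 'M[A]_m;
  rep1 : forall A : kalg k, rep_mx (1%g : G A) = 1%:M;
  repM : forall (A : kalg k) (g h : G A),
    rep_mx (g * h)%g = rep_mx g *m rep_mx h;
  rep_nat : forall (A B : kalg k) (f : khom A B) (g : G A),
    rep_mx (gmap G f g) = map_mx f (rep_mx g) }.

Definition ext (k : fieldType) (A : kalg k) (p q : nat) (M : 'M[k]_(p, q)) :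
  'M[A]_(p, q) := map_mx (kalg_str A) M.

(* Membership in X_A, the A-submodule of A^m generated by X. *)
Definition in_ext (k : fieldType) (A : kalg k) (m : nat)
    (X : {vspace 'cV[k]_m}) (v : 'cV[A]_m) : Prop :=
  exists c : 'I_(\dim X) -> A,
    v = \sum_(i < \dim X) c i *: ext A (tnth (vbasis X) i).

Definition stabilizer (k : fieldType) (G : gfunctor k) (m : nat)
    (rho : rep G m) (X : {vspace 'cV[k]_m}) : subfunctor G :=
  fun A g => forall v : 'cV[A]_m, in_ext X v <-> in_ext X (rho A g *m v).

Definition irreducible_rep (k : fieldType) (G : gfunctor k) (m : nat)
    (rho : rep G m) : Prop :=
  (0 < m)%N /\ forall X : {vspace 'cV[k]_m},
    (forall (A : kalg k) (g : G A), stabilizer rho X g) ->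
    X = 0%VS \/ X = fullv.

(* T acts on v through the character w. *)
Definition weight_vector (k : fieldType) (n : nat) (G : gfunctor k)
    (x : root_maps n G) (m : nat) (rho : rep G m) (w : 'rV[int]_n)
    (v : 'cV[k]_m) : Prop :=
  forall (A : kalg k) (t : A), t \is a GRing.unit -> forall i : 'I_n,
    rho A (coroot x (simple_root i) t) *m ext A v
    = (t ^ dot w (simple_root i)) *: ext A v.

Definition highest_weight_vector (k : fieldType) (n : nat) (G : gfunctor k)
    (x : root_maps n G) (m : nat) (rho : rep G m) (w : 'rV[int]_n)
    (v : 'cV[k]_m) : Prop :=
  [/\ v != 0, weight_vector x rho w v
    & forall r, is_pos_root r -> forall (A : kalg k) (u : A),
        rho A (x r A u) *m ext A v = ext A v].

(* For a matrix b, the bilinear form is b(v, w) = v^T b w. *)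
Definition bform (k : fieldType) (m : nat) (b : 'M[k]_m) (v w : 'cV[k]_m) : k :=
  (v^T *m b *m w) 0 0.

Definition invariant_form (k : fieldType) (G : gfunctor k) (m : nat)
    (rho : rep G m) (b : 'M[k]_m) : Prop :=
  forall (A : kalg k) (g : G A), (rho A g)^T *m ext A b *m rho A g = ext A b.

Definition SO (k : fieldType) (m : nat) (b : 'M[k]_m) (A : kalg k)
    (M : 'M[A]_m) : Prop :=
  M^T *m ext A b *m M = ext A b /\ \det M = 1.

Definition conj_by (k : fieldType) (m : nat) (s : 'M[k]_m) (A : kalg k)
    (M : 'M[A]_m) : 'M[A]_m :=
  ext A s *m M *m ext A (invmx s).

(** * The geometry *)

Definition act (k : fieldType) (m : nat) (M : 'M[k]_m) (X : {vspace 'cV[k]_m}) :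
    {vspace 'cV[k]_m} :=
  (linfun (mulmx M : 'cV[k]_m -> 'cV[k]_m) @: X)%VS.

Definition is_span (k : fieldType) (m : nat) (S : 'cV[k]_m -> Prop)
    (W : {vspace 'cV[k]_m}) : Prop :=
  (forall v, S v -> v \in W) /\
  forall W' : {vspace 'cV[k]_m}, (forall v, S v -> v \in W') -> (W <= W')%VS.

Section Geometry.

Variables (k : fieldType) (n : nat) (G : gfunctor k) (x : root_maps n G).
Variables (m : nat) (rho : rep G m) (v : 'cV[k]_m).
Arguments x : clear implicits.

Definition levi (d : 'I_n) : subfunctor G :=
  generated (fun (A : kalg k) (h : G A) =>
    exists r, is_component_root d r /\ exists u : A, h = x r A u).

(* W is the subspace V_d attached to the simple root d. *)
Definition is_Vdelta (d : 'I_n) (W : {vspace 'cV[k]_m}) : Prop :=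
  if d == 0%N :> nat then W = <[v]>%VS
  else is_span (fun w => exists2 g : G (base k), levi d g & w = rho (base k) g *m v)
         W.

Definition has_type (X : {vspace 'cV[k]_m}) (d : 'I_n) : Prop :=
  exists (g : G (base k)) (W : {vspace 'cV[k]_m}),
    is_Vdelta d W /\ X = act (rho (base k) g) W.

Definition is_object (X : {vspace 'cV[k]_m}) : Prop :=
  exists d : 'I_n, has_type X d.

Definition incident (X Y : {vspace 'cV[k]_m}) : Prop :=
  exists P : subfunctor G,
    [/\ parabolic P, sub_incl P (stabilizer rho X)
      & sub_incl P (stabilizer rho Y)].

(* The restriction of F to the objects is an automorphism of the geometry: a
   permutation of the objects which preserves incidence in both directions and
   permutes the types. *)
Definition geometry_automorphism
    (F : {vspace 'cV[k]_m} -> {vspace 'cV[k]_m}) : Prop :=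
  [/\ forall X, is_object X -> is_object (F X),
      forall X Y, is_object X -> is_object Y -> F X = F Y -> X = Y,
      forall Y, is_object Y -> exists2 X, is_object X & F X = Y,
      forall X Y, is_object X -> is_object Y ->
        (incident X Y <-> incident (F X) (F Y))
    & exists2 sigma : 'I_n -> 'I_n, bijective sigma & forall X d,
        is_object X -> (has_type X d <-> has_type (F X) (sigma d))].

(* For every object X, F X is the unique object whose stabilizer is the image
   under phi of the stabilizer of X. *)
Definition induced_by (phi : ghom G G)
    (F : {vspace 'cV[k]_m} -> {vspace 'cV[k]_m}) : Prop :=
  forall X, is_object X -> is_object (F X) /\
    forall Y, is_object Y ->
      (sub_eq (stabilizer rho Y) (sub_image phi (stabilizer rho X)) <-> Y = F X).

End Geometry.

(* Main.v *)
Require Import Defs.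
From mathcomp Require Import all_boot all_order all_algebra.
From mathcomp Require Import zify.
From Stdlib Require Import IndefiniteDescription.
Set Implicit Arguments.
Unset Strict Implicit.
Unset Printing Implicit Defensive.
Import Order.TTheory GRing.Theory Num.Theory.
Local Open Scope ring_scope.

(** Write V_d for the span of the weight vectors whose weight pairs maximally
    with the fundamental (co)weight dual to the simple root d.  Expanding
    rho(x_r(u)) in powers of u over k[u] and conjugating by the torus shows that
    each root subgroup acts as 1 + u E_r with E_r shifting weights by r; hence
    V_d is the subspace attached to d, and s, which flips the sign of
    the last coordinate of each weight, exchanges V_{n-1} with V_n and fixes the
    other V_d.  Together with s rho(g) s^-1 = rho(phi(g)) this makes s permute
    the objects, and phi carries stabilizers to stabilizers and parabolic
    subgroups to parabolic subgroups.  Finally V_d is the only nonzero totally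
    isotropic subspace stable under its own stabilizer, so an object is
    determined by its stabilizer. *)

(** * Automorphisms and parabolic subgroups *)

Lemma ghom1 (k : fieldType) (G H : gfunctor k) (phi : ghom G H) (A : kalg k) :
  phi A 1%g = 1%g.
Proof. by apply: (@mulgI _ (phi A 1%g)); rewrite -ghomM !mulg1. Qed.

Lemma ghomV (k : fieldType) (G H : gfunctor k) (phi : ghom G H) (A : kalg k)
    (g : G A) : phi A (g^-1)%g = ((phi A g)^-1)%g.
Proof. by apply: (@mulgI _ (phi A g)); rewrite -ghomM !mulgV ghom1. Qed.

Lemma gmap1 (k : fieldType) (G : gfunctor k) (A B : kalg k) (f : khom A B) :
  gmap G f 1%g = 1%g.
Proof. by apply: (@mulgI _ (gmap G f 1%g)); rewrite -gmapM !mulg1. Qed.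

Lemma gmapV (k : fieldType) (G : gfunctor k) (A B : kalg k) (f : khom A B)
    (g : G A) : gmap G f (g^-1)%g = ((gmap G f g)^-1)%g.
Proof. by apply: (@mulgI _ (gmap G f g)); rewrite -gmapM !mulgV gmap1. Qed.

(** Bijectivity is given separately over each algebra, so choice collects the inverses into one
    family; multiplicativity and naturality follow by cancelling the injective [phi A]. *)
Lemma gautomorphism_inverse (k : fieldType) (G : gfunctor k) (phi : ghom G G) :
  gautomorphism phi ->
  exists psi : ghom G G,
    (forall A, cancel (phi A) (psi A)) /\ (forall A, cancel (psi A) (phi A)).
Proof.
move=> aut.
have inv A : {h : G A -> G A | cancel (phi A) h /\ cancel h (phi A)}.
  by apply: constructive_indefinite_description; case: (aut A) => h ? ?; exists h.
pose h A := sval (inv A).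
have hK A : cancel (phi A) (h A) by case: (svalP (inv A)).
have Kh A : cancel (h A) (phi A) by case: (svalP (inv A)).
have hM A : forall x y : G A, h A (x * y)%g = (h A x * h A y)%g.
  by move=> x y; apply: (can_inj (hK A)); rewrite ghomM !Kh.
have hnat A B (f : khom A B) (x : G A) : h B (gmap G f x) = gmap G f (h A x).
  by apply: (can_inj (hK B)); rewrite ghom_nat !Kh.
by exists (GHom hM hnat).
Qed.

Section Preimage.

Variables (k : fieldType) (G : gfunctor k).

(** For [psi] inverse to [phi] this is the image of [P] under [phi]; written as a preimage, its
    equations are those of [P] composed with [psi]. *)
Definition preim_sub (psi : ghom G G) (P : subfunctor G) : subfunctor G :=
  fun A g => P A (psi A g).

Lemma is_subgroup_preim (psi : ghom G G) A (S : G A -> Prop) :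
  is_subgroup S -> is_subgroup (fun g => S (psi A g)).
Proof.
case=> S1 SM SV; split; first by rewrite ghom1.
  by move=> g h Sg Sh; rewrite ghomM; apply: SM.
by move=> g Sg; rewrite ghomV; apply: SV.
Qed.

Lemma regular_fun_comp (psi : ghom G G) (f : forall A : kalg k, G A -> A) :
  regular_fun f -> regular_fun (fun A g => f A (psi A g)).
Proof. by move=> rf A B h g; rewrite ghom_nat rf. Qed.

Lemma closed_subgroup_preim (psi : ghom G G) (P : subfunctor G) :
  closed_subgroup P -> closed_subgroup (preim_sub psi P).
Proof.
case=> [[I [Ireg IP]] Psub]; split; last by move=> A; apply: is_subgroup_preim.
exists (fun f => exists2 f0, I f0 & f = fun A g => f0 A (psi A g)); split.
  by move=> _ [f0 If0 ->]; apply/regular_fun_comp/Ireg.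
move=> A g; split=> [/IP Pg _ [f0 If0 ->]|Pg]; first exact: Pg.
by apply/IP => f0 If0; apply: (Pg (fun A g => f0 A (psi A g))); exists f0.
Qed.

Variable K : kalg k.

Lemma Kclosed_subgroup_preim (psi : ghom G G) (Z : G K -> Prop) :
  Kclosed_subgroup Z -> Kclosed_subgroup (fun g => Z (psi K g)).
Proof.
case=> [[I [Ireg IZ]] Zsub]; split; last exact: is_subgroup_preim.
exists (fun F => exists2 F0, I F0 & F = fun g => F0 (psi K g)); split.
  move=> _ [F0 /Ireg [d [c [f [freg fE]]]] ->].
  exists d, c, (fun i A g => f i A (psi A g)); split; last by [].
  by move=> i; apply: regular_fun_comp.
move=> g; split=> [/IZ Zg _ [F0 IF0 ->]|Zg]; first exact: Zg.
by apply/IZ => F0 IF0; apply: (Zg (fun g => F0 (psi K g))); exists F0.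
Qed.

Lemma derived_preim (psi : ghom G G) (Z : G K -> Prop) i g :
  derived (fun g => Z (psi K g)) i g -> derived Z i (psi K g).
Proof.
elim: i g => [|i IHi] //= g dg S subS commS.
apply: (dg (fun g => S (psi K g))); first exact: is_subgroup_preim.
by move=> x y /IHi dx /IHi dy; rewrite !ghomM !ghomV; apply: commS.
Qed.

Variables (phi psi : ghom G G).
Hypotheses (phiK : forall A, cancel (phi A) (psi A)).
Hypotheses (psiK : forall A, cancel (psi A) (phi A)).

(** A closed subgroup of finite index in the preimage is pulled back along [phi] to one in [Z], with
    coset representatives moved by [psi]; connectedness of [Z] then applies. *)
Lemma Kconnected_preim (Z : G K -> Prop) :
  Kconnected Z -> Kconnected (fun g => Z (psi K g)).
Proof.
move=> conZ Z' clZ' subZ' [r rP] g Zg.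
rewrite -[g]psiK; apply: (conZ (fun g => Z' (phi K g))) => //.
- exact: Kclosed_subgroup_preim.
- by move=> h /subZ'; rewrite phiK.
exists (map (psi K) r) => h Zh.
have [|h0 h0r Zh0] := rP (phi K h); first by rewrite phiK.
by exists (psi K h0); rewrite ?map_f // ghomM ghomV psiK.
Qed.

Lemma abs_solvable_preim (Z : G K -> Prop) :
  abs_solvable Z -> abs_solvable (fun g => Z (psi K g)).
Proof.
by case=> d dZ; exists d => g /derived_preim/dZ e1; rewrite -[g]psiK e1 ghom1.
Qed.

End Preimage.

Section Automorphism.

Variables (k : fieldType) (G : gfunctor k) (phi psi : ghom G G).
Hypotheses (phiK : forall A, cancel (phi A) (psi A)).
Hypotheses (psiK : forall A, cancel (psi A) (phi A)).

(** Maximality is transported backwards: a larger closed connected solvable subgroup is pulled back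
    along [phi] to one containing [Z]. *)
Lemma Borel_preim (K : kalg k) (Z : G K -> Prop) :
  Borel Z -> Borel (fun g => Z (psi K g)).
Proof.
case=> [[clZ conZ solZ] maxZ]; split.
  split; [exact: Kclosed_subgroup_preim|exact: Kconnected_preim|].
  exact: abs_solvable_preim.
move=> Z' [clZ' conZ' solZ'] ZZ' g Z'g.
apply: (maxZ (fun g => Z' (phi K g))); last by rewrite psiK.
  split; [exact: Kclosed_subgroup_preim|exact: Kconnected_preim|].
  exact: abs_solvable_preim.
by move=> h Zh; apply: ZZ'; rewrite phiK.
Qed.

Lemma parabolic_preim (P : subfunctor G) :
  parabolic P -> parabolic (preim_sub psi P).
Proof.
case=> clP [K [iota [Z bZ ZP]]]; split; first exact: closed_subgroup_preim.
exists K, iota, (fun g => Z (psi (KAlg iota) g)); first exact: Borel_preim.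
by move=> g /ZP.
Qed.

End Automorphism.

(** * Weights and roots of D_n *)

Section Dot.

Variable n : nat.
Implicit Types y z : 'rV[int]_n.

Lemma dotC y z : dot y z = dot z y.
Proof. by apply: eq_bigr => j _; rewrite mulrC. Qed.

Lemma dotDl y y' z : dot (y + y') z = dot y z + dot y' z.
Proof. by rewrite -big_split; apply: eq_bigr => j _; rewrite mxE mulrDl. Qed.

Lemma dotNl y z : dot (- y) z = - dot y z.
Proof. by rewrite /dot -sumrN; apply: eq_bigr => j _; rewrite mxE mulNr. Qed.

Lemma dotBl y y' z : dot (y - y') z = dot y z - dot y' z.
Proof. by rewrite dotDl dotNl. Qed.

Lemma dot0l z : dot 0 z = 0.
Proof. by rewrite /dot big1 // => j _; rewrite mxE mul0r. Qed.

Lemma dotMzl y c z : dot (y *~ c) z = dot y z * c.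
Proof.
have E j : (y *~ c) 0 j = y 0 j * c by rewrite -scaler_int mxE intz mulrC.
by rewrite /dot mulr_suml; apply: eq_bigr => j _; rewrite E mulrAC.
Qed.

Lemma dotMnl y c z : dot (y *+ c) z = dot y z *+ c.
Proof. by rewrite [in LHS]pmulrn dotMzl -mulrzz. Qed.

Lemma dot_suml (I : finType) (F : I -> 'rV[int]_n) z :
  dot (\sum_i F i) z = \sum_i dot (F i) z.
Proof.
apply: (big_ind2 (fun u v => dot u z = v)) => //; first exact: dot0l.
by move=> u1 v1 u2 v2 <- <-; rewrite dotDl.
Qed.

Lemma dot_unit_vec (i : 'I_n) z : dot (unit_vec n i) z = z 0 i.
Proof.
rewrite /dot (bigD1 i) //= mxE eqxx mul1r big1 ?addr0 // => j ji.
by rewrite mxE (inj_eq val_inj) (negPf ji) mul0r.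
Qed.

Lemma dot_unit_unit i j :
  (i < n)%N -> dot (unit_vec n i) (unit_vec n j) = (i == j)%:R.
Proof. by move=> lt_in; rewrite (dot_unit_vec (Ordinal lt_in)) mxE. Qed.

End Dot.

Section Weights.

Variable n : nat.

Notation sroot := (@simple_root n).
Implicit Types d i j : 'I_n.

Lemma dot_simple_root y i :
  dot y (sroot i) =
  if (i.+1 < n)%N then dot y (unit_vec n i) - dot y (unit_vec n i.+1)
  else dot y (unit_vec n n.-2) + dot y (unit_vec n n.-1).
Proof. by rewrite /sroot; case: ifP => _; rewrite !(dotC y) ?dotBl ?dotDl. Qed.

Lemma is_rootN (r : 'rV[int]_n) : is_root r -> is_root (- r).
Proof. by rewrite /is_root dotNl dotC dotNl opprK. Qed.

(** The sum telescopes: only simple roots of index below [i] occur, and these all have the form u_j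
    - u_(j+1). *)
Lemma eps_unit_vec (i : 'I_n) : eps i = unit_vec n i.
Proof.
rewrite /eps (eq_bigr (fun j : 'I_n => unit_vec n j - unit_vec n j.+1)); last first.
  by move=> j lt_ji; rewrite /sroot ifT //; have := ltn_ord i; lia.
rewrite -(big_ord_widen n (fun j : nat => unit_vec n j - unit_vec n j.+1)
  (ltnW (ltn_ord i))).
rewrite -(big_mkord xpredT (fun j : nat => unit_vec n j - unit_vec n j.+1)).
rewrite -[X in _ - X]opprK -sumrN.
under eq_bigr do rewrite opprB.
by rewrite telescope_sumr // /omega1 opprK addrC subrK.
Qed.

(* The weights of V: (i, false) stands for eps_i and (i, true) for - eps_i. *)
Definition wt (p : 'I_n * bool) : 'rV[int]_n :=
  if p.2 then - unit_vec n p.1 else unit_vec n p.1.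

Definition wt_opp (p : 'I_n * bool) : 'I_n * bool := (p.1, ~~ p.2).

Lemma wt_oppK : involutive wt_opp.
Proof. by case=> i a; rewrite /wt_opp /= negbK. Qed.

Lemma dot_wt p y : dot (wt p) y = (if p.2 then -1 else 1) * y 0 p.1.
Proof.
by rewrite /wt; case: p => i [] /=; rewrite ?dotNl dot_unit_vec ?mulN1r ?mul1r.
Qed.

Lemma dot_wt_wt p q :
  dot (wt p) (wt q) = (p == q)%:R - (p == wt_opp q)%:R.
Proof.
rewrite dot_wt /wt /wt_opp; case: p q => [i a] [j c]; rewrite !xpair_eqE /=.
have -> : (i == j) = (i == j :> nat) by [].
by case: a c => [] [] /=; rewrite !mxE; case: (_ == _); rewrite ?andbF ?andbT /=; lia.
Qed.

Lemma wt_opp_neq p : (p == wt_opp p) = false.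
Proof. by case: p => i []; rewrite xpair_eqE andbF. Qed.

(** A weight pairs to 1 with itself, whereas distinct indices pair to 0 or -1. *)
Lemma wt_inj : injective wt.
Proof.
move=> p q eq_pq; have := dot_wt_wt p q; rewrite -eq_pq dot_wt_wt eqxx wt_opp_neq.
by case: (p =P q) => // _; case: (p == _) => /eqP.
Qed.

(* The squared distance of two distinct weights is 2 or 4, and the roots have
   squared length 2. *)
Lemma wt_root_string p q r (j : nat) :
  is_root r -> wt q = wt p + r *+ j -> (j <= 1)%N.
Proof.
move=> r2 eq_q; have : dot (wt q - wt p) (wt q - wt p) = 2 * j%:Z ^+ 2.
  rewrite eq_q addrC addKr dotMnl dotC dotMnl r2; nia.
rewrite dotBl !(dotC _ (_ - _)) !dotBl !dot_wt_wt !eqxx => E.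
have : 2 * j%:Z ^+ 2 <= 4.
  by rewrite -E; lia.
nia.
Qed.

(** Both weights have square length 1 and the root has square length 2, so expanding the square
    length of [wt p + r] gives 1 = 1 + 2 (wt p, r) + 2. *)
Lemma dot_wt_root p q r : is_root r -> wt q = wt p + r -> dot (wt p) r = -1.
Proof.
move=> r2 eq_q; have := dot_wt_wt q q; rewrite {1 2}eq_q.
rewrite dotDl !(dotC _ (_ + _)) !dotDl (dotC r) r2 dot_wt_wt !eqxx !wt_opp_neq /=; lia.
Qed.

Lemma wt_e_succ (i j : 'I_n) :
  j = i.+1 :> nat -> wt (j, false) = wt (i, false) - sroot i.
Proof.
move=> ji; rewrite /wt /sroot /= ifT; last by have := ltn_ord j; lia.
by rewrite ji opprB addrC subrK.
Qed.

Lemma wt_f_succ (i j : 'I_n) :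
  j = i.+1 :> nat -> wt (j, true) = wt (i, true) + sroot i.
Proof.
move=> ji; rewrite /wt /sroot /= ifT; last by have := ltn_ord j; lia.
by rewrite ji addrA addNr add0r.
Qed.

Lemma wt_e_f (i j : 'I_n) :
  i.+2 = n -> j.+1 = n -> wt (j, true) = wt (i, false) - sroot j.
Proof.
move=> i2 j1; rewrite /wt /sroot /= ifF; last by lia.
have -> : n.-2 = i by lia. have -> : n.-1 = j by lia.
by rewrite opprD addrA subrr add0r.
Qed.

(* The fundamental weight dual to the simple root d, doubled for the two half
   spin weights. *)
Definition fweight (d : 'I_n) : 'rV[int]_n :=
  \row_(j < n) if d.+2 == n then (if j.+1 == n then -1 else 1) else (j <= d)%:R.

Definition topwt (d : 'I_n) (p : 'I_n * bool) : bool :=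
  dot (wt p) (fweight d) == 1.

(** The pairing is plus or minus one coordinate of [fweight d]. The top weights are therefore the
    first [d.+1] of the eps_i, except that for Bourbaki's alpha_(n-1) they are eps_1, ..., eps_(n-1)
    and -eps_n. *)
Lemma topwtE d p :
  topwt d p = if d.+2 == n then (p.1.+1 == n) == p.2
              else (p.1 <= d)%N && ~~ p.2.
Proof.
rewrite /topwt dot_wt mxE; case: p => i a /=.
by case: a; case: (d.+2 == n); case: (i.+1 == n); case: (i <= d)%N.
Qed.

Lemma dot_wt_fweight_le1 d p : dot (wt p) (fweight d) <= 1.
Proof.
rewrite dot_wt mxE; case: p => i a /=.
by case: a; case: (d.+2 == n); case: (i.+1 == n); case: (i <= d)%N.
Qed.

Lemma wt_oppE p : wt (wt_opp p) = - wt p.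
Proof. by case: p => i []; rewrite /wt /= ?opprK. Qed.

Lemma topwt_opp d p : topwt d p -> ~~ topwt d (wt_opp p).
Proof. by rewrite /topwt wt_oppE dotNl => /eqP ->. Qed.

(** The value 1 is already the maximum of the pairing, so a root pairing nonnegatively cannot change
    it. *)
Lemma topwt_raise d r p q :
  0 <= dot r (fweight d) -> wt q = wt p + r -> topwt d p -> topwt d q.
Proof.
rewrite /topwt => r_ge0 eq_q /eqP p1; rewrite eq_le dot_wt_fweight_le1 eq_q dotDl p1.
lia.
Qed.

Hypothesis n_ge4 : (4 <= n)%N.

Lemma is_root_simple_root i : is_root (sroot i).
Proof.
rewrite /is_root dot_simple_root !(dotC (sroot i)) !dot_simple_root.
by case: i => i /= lt_in; case: ifP => i1; rewrite ?i1 !dot_unit_unit ?eqxx; lia.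
Qed.

(** The chain roots u_j - u_(j+1) force all coordinates of [y] to be equal, and u_(n-1) + u_n then
    forces twice their common value to vanish. *)
Lemma simple_root_separates y : (forall i, dot y (sroot i) = 0) -> y = 0.
Proof.
move=> y0; pose Y m := dot y (unit_vec n m).
have YS m : (m.+1 < n)%N -> Y m.+1 = Y m.
  move=> lt_mn; have := y0 (Ordinal (ltnW lt_mn)).
  by rewrite dot_simple_root /= lt_mn => /eqP; rewrite subr_eq0 => /eqP.
have Y0 m : (m < n)%N -> Y m = Y 0%N.
  by elim: m => // m IHm lt_mn; rewrite YS // IHm // ltnW.
have lt_l : (n.-1 < n)%N by lia.
have := y0 (Ordinal lt_l); rewrite dot_simple_root /= ifN; last by lia.
rewrite -/(Y _) -/(Y _) !Y0; try lia.
move=> Y00; apply/rowP => i; rewrite mxE -dot_unit_vec dotC -/(Y i) Y0 //; lia.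
Qed.

(** Nonnegativity will put every simple root subgroup into the stabilizer of V_d; vanishing adds the
    opposite root subgroups for [i != d]. *)
Lemma dot_simple_root_fweight d i :
  (0 <= dot (sroot i) (fweight d)) /\
  (i != d -> dot (sroot i) (fweight d) = 0).
Proof.
rewrite dotC dot_simple_root !(dotC (fweight d)).
have Yn m (lt_mn : (m < n)%N) : dot (unit_vec n m) (fweight d) =
    if d.+2 == n then (if m.+1 == n then -1 else 1) else (m <= d)%:R.
  by rewrite (dot_unit_vec (Ordinal lt_mn)) mxE.
have := ltn_ord i; have := ltn_ord d.
have -> : (i != d) = (i != d :> nat) by [].
by case: ifP => i1; rewrite !Yn; try lia; do ?case: eqP => ?; lia.
Qed.

Lemma in_component_neq d j : d != 0%N :> nat -> in_component d j -> j != d.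
Proof.
move=> d0 [i0 i00 /connectP [s path_s ->]].
(* Either the path is empty and [j] is the first simple root, or its last edge ends at [j] and
   avoids [d] by definition. *)
case/lastP: s path_s => [_|s z] /=; first by apply: contraNneq d0 => <-; rewrite i00.
by rewrite last_rcons rcons_path => /andP [_ /and4P [_ ? _ _]].
Qed.

Lemma component_root_fweight d r :
  d != 0%N :> nat -> is_component_root d r -> dot r (fweight d) = 0.
Proof.
move=> d0 [_ [c [cP ->]]]; rewrite dot_suml big1 // => j _; rewrite dotMzl.
have [->|cj] := eqVneq (c j) 0; first by rewrite mulr0.
have [_ ->] := dot_simple_root_fweight d j; first by rewrite mul0r.
exact/in_component_neq/cP.
Qed.

Lemma in_component_lt (d j : 'I_n) : (j < d)%N -> in_component d j.
Proof.
case: j => j lt_jn /=; elim: j lt_jn => [|j IHj] lt_jn lt_jd.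
  by exists (Ordinal lt_jn) => //; apply: connect0.
have lt_jn' := ltnW lt_jn.
have [i0 i00 con] := IHj lt_jn' (ltnW lt_jd); exists i0 => //.
apply: (connect_trans con); apply: connect1 => /=.
have nd (i : 'I_n) : (i < d)%N -> i != d.
  by move=> lt_id; apply: contraTneq lt_id => ->; rewrite ltnn.
rewrite !nd //=; last exact: ltnW.
rewrite -val_eqE /= neq_ltn ltnSn /=.
rewrite dot_simple_root !(dotC (sroot _)) !dot_simple_root /=.
have := ltn_ord d => lt_d; rewrite !ifT; try lia.
by rewrite !dot_unit_unit ?eqxx; lia.
Qed.

(** With alpha_(n-1) removed, alpha_n is still reached through the branching node alpha_(n-2), whose
    shifted index is [n.-2.-1]. *)
Lemma in_component_last (d j : 'I_n) :
  d.+2 = n -> j.+1 = n -> in_component d j.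
Proof.
move=> d2 j1; have lt_i : (n.-2.-1 < n)%N by lia.
have [|i0 i00 con] := @in_component_lt d (Ordinal lt_i); first by rewrite /=; lia.
exists i0 => //; apply: (connect_trans con); apply: connect1 => /=.
rewrite -!val_eqE /=; apply/and4P; split; try lia.
rewrite dot_simple_root !(dotC (sroot _)) !dot_simple_root /=.
have -> : ((n.-2.-1).+1 < n)%N by lia.
have -> : (j.+1 < n)%N = false by lia.
by rewrite !dot_unit_unit ?eqxx; lia.
Qed.

Lemma in_component_simple_root d j : d != 0%N :> nat -> in_component d j ->
  is_component_root d (- sroot j).
Proof.
move=> d0 compj; split; first exact/is_rootN/is_root_simple_root.
exists (fun i => if i == j then -1 else 0); split.
  by move=> i; case: (i =P j) => [->|].
rewrite (bigD1 j) //= eqxx mulrN1z big1 ?addr0 // => i /negPf ->; exact: mulr0z.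
Qed.

(** An induction principle: subtracting simple roots of the component leads from eps_1 down the
    chain eps_1, eps_2, ... through all top weights; for alpha_(n-1) the last step is -eps_n =
    eps_(n-1) - alpha_n. *)
Lemma topwt_min d (Q : 'I_n * bool -> Prop) :
  (forall i : 'I_n, i = 0%N :> nat -> Q (i, false)) ->
  (d != 0%N :> nat -> forall j p q, in_component d j ->
     wt q = wt p - sroot j -> Q p -> Q q) ->
  forall p, topwt d p -> Q p.
Proof.
move=> Q0 Qlow.
have Qe m (lt_mn : (m < n)%N) : (m <= d)%N -> Q (Ordinal lt_mn, false).
  elim: m lt_mn => [|m IHm] lt_mn le_md; first exact: Q0.
  apply: (Qlow _ (Ordinal (ltnW lt_mn)) _ _ _ _ (IHm (ltnW lt_mn) (ltnW le_md))).
  - by lia.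
  - exact: in_component_lt.
  - exact: wt_e_succ.
case=> -[i lt_i] a; rewrite topwtE /=; case: eqP => [d2|_]; last first.
  by case: a; rewrite ?andbF // andbT; apply: Qe.
case: a; case: (eqVneq i.+1 n) => // i1 _; last by apply: Qe; lia.
apply: (Qlow _ (Ordinal lt_i) _ _ _ _ (Qe d (ltn_ord d) (leqnn d))).
- by lia.
- exact: in_component_last.
- exact: wt_e_f.
Qed.

(* Raising reaches the highest weight, hence Q contains topwt d; it also reaches
   eps_(d+1) from any weight outside topwt d and its opposite, and lowering
   from there would put both eps_n and - eps_n in Q. *)
Lemma topwt_unique d (Q : 'I_n * bool -> Prop) :
  (forall j p q, wt q = wt p + sroot j -> Q p -> Q q) ->
  (forall j p q, j != d -> wt q = wt p - sroot j -> Q p -> Q q) ->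
  (forall p, Q p -> Q (wt_opp p) -> False) ->
  (exists p, Q p) -> forall p, Q p <-> topwt d p.
Proof.
move=> Qup Qlow Qiso [p0 Qp0].
have upe (i j : 'I_n) : (i <= j)%N -> Q (j, false) -> Q (i, false).
  case: j => j lt_j /=; elim: j lt_j => [|j IHj] lt_j.
    by rewrite leqn0 => /eqP i0; rewrite (_ : i = Ordinal lt_j) //; apply/val_inj.
  rewrite leq_eqVlt ltnS => /orP [/eqP ij|le_ij Qj].
    by rewrite (_ : i = Ordinal lt_j) //; apply/val_inj.
  apply: (IHj (ltnW lt_j) le_ij); apply: (Qup (Ordinal (ltnW lt_j)) _ _ _ Qj).
  by rewrite (@wt_e_succ (Ordinal (ltnW lt_j)) (Ordinal lt_j)) // subrK.
have upf (j : 'I_n) m (lt_m : (m < n)%N) :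
    (j <= m)%N -> Q (j, true) -> Q (Ordinal lt_m, true).
  elim: m lt_m => [|m IHm] lt_m.
    by rewrite leqn0 => /eqP j0; rewrite (_ : j = Ordinal lt_m) //; apply/val_inj.
  rewrite leq_eqVlt ltnS => /orP [/eqP jm|le_jm Qj].
    by rewrite (_ : j = Ordinal lt_m) //; apply/val_inj.
  apply: (Qup (Ordinal (ltnW lt_m)) _ _ _ (IHm (ltnW lt_m) le_jm Qj)).
  exact: wt_f_succ.
have lt_l1 : (n.-1 < n)%N by lia. have lt_l2 : (n.-2 < n)%N by lia.
pose l1 := Ordinal lt_l1; pose l2 := Ordinal lt_l2.
have l1n : l1.+1 = n by rewrite /=; lia.
have l2n : l2.+2 = n by rewrite /=; lia.
(* The negative weights climb to -eps_n and cross over to the positive ones by -eps_n + alpha_n =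
   eps_(n-1). *)
have upfe (j : 'I_n) : Q (j, true) -> Q (l2, false).
  move=> Qj; have : Q (l1, true) by apply: upf Qj; have := ltn_ord j; lia.
  by apply: (Qup l1); rewrite (wt_e_f l2n l1n) subrK.
have Q0 (i : 'I_n) : i = 0%N :> nat -> Q (i, false).
  move=> i0; case: p0 Qp0 => j [/upfe|]; first by apply: upe; lia.
  by apply: upe; lia.
have Qtop : forall p, topwt d p -> Q p.
  apply: topwt_min => // d0 j p q /in_component_neq -/(_ d0); exact: Qlow.
have Qbad (m : nat) (lt_m : (m < n)%N) :
    (d < m)%N -> d.+2 != n -> Q (Ordinal lt_m, false) -> False.
  move=> lt_dm d2 /upe Qm.
  have low m' (lt_m' : (m' < n)%N) : (d < m')%N -> Q (Ordinal lt_m', false).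
    elim: m' lt_m' => // m' IHm lt_m'; rewrite ltnS leq_eqVlt.
    case/orP => [/eqP dm|lt_dm']; first by apply: Qm => /=; lia.
    apply: (Qlow (Ordinal (ltnW lt_m')) (Ordinal (ltnW lt_m'), false)).
    - by rewrite -val_eqE /=; lia.
    - exact: wt_e_succ.
    - exact: IHm.
  have lt_d2 : (d < l2)%N by rewrite /=; lia.
  apply: (Qiso (l1, false)); first by apply: low; move: lt_d2 => /=; lia.
  apply: (Qlow l1 (l2, false)); last exact: low.
    by rewrite -val_eqE /=; move: lt_d2 => /=; lia.
  exact: wt_e_f.
move=> p; split=> [Qp|]; last exact: Qtop.
apply/negPn/negP => np; case: (boolP (topwt d (wt_opp p))) => [/Qtop|nop].
  exact: Qiso Qp.
(* For alpha_(n-1) every weight is top or opposite to a top one, so this case is already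
   contradictory. *)
move: np nop; rewrite !topwtE; case: eqP => [_|/eqP d2].
  by case: p {Qp} => i [] /=; case: (_ == n).
case: p Qp => -[i lt_i] a /= Qp np nop.
have lt_di : (d < i)%N by move: np nop; case: a {Qp}; rewrite /= ?andbT; lia.
case: a Qp {np nop} => [Qp|]; last exact: Qbad.
by have /Qbad := upfe _ Qp; apply=> //=; lia.
Qed.

(** * Sign change of the last coordinate and the diagram automorphism *)

Definition wt_flip (p : 'I_n * bool) : 'I_n * bool :=
  (p.1, p.2 (+) (p.1.+1 == n)).

Lemma wt_flipK : involutive wt_flip.
Proof. by case=> i a; rewrite /wt_flip /= addbK. Qed.

Lemma wt_flip_opp p : wt_flip (wt_opp p) = wt_opp (wt_flip p).
Proof. by case: p => i a; rewrite /wt_flip /wt_opp /= addNb. Qed.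

(** The diagram automorphism exchanging the last two nodes. The default [d] of [insubd] is never
    returned as a fallback, since the chosen number is always below [n]. *)
Definition type_swap (d : 'I_n) : 'I_n :=
  insubd d (if d.+2 == n then n.-1 else if d.+1 == n then n.-2 else d).

Lemma type_swapE (d : 'I_n) : type_swap d =
  (if d.+2 == n then n.-1 else if d.+1 == n then n.-2 else d) :> nat.
Proof.
by rewrite val_insubd ifT //; have := ltn_ord d; do 2 (case: eqP => _; try lia).
Qed.

Lemma type_swapK : involutive type_swap.
Proof.
move=> d; apply: val_inj; rewrite /= !type_swapE; have := ltn_ord d.
by case: eqP; try lia; case: eqP; try lia; do 2 (case: eqP; try lia).
Qed.

(** Changing the sign of the last coordinate exchanges the doubled half-spin weights (1, ..., 1, -1)
    and (1, ..., 1) and fixes the other [fweight d], whose last coordinate is 0. *)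
Lemma topwt_flip d p : topwt (type_swap d) (wt_flip p) = topwt d p.
Proof.
rewrite !topwtE type_swapE; case: p => i a /=.
have := ltn_ord d; have := ltn_ord i.
move: (nat_of_ord i) (nat_of_ord d) => {}i {}d lt_i lt_d.
by case: a; case: (i.+1 =P n) => ?; case: (d.+2 =P n) => ?; case: (d.+1 =P n) => ?;
  rewrite /= ?andbT ?andbF; try lia; do ?case: ifP; lia.
Qed.

End Weights.

(** * Subspaces and their stabilizers *)

(** In characteristic zero 2 has infinite order in the multiplicative group, so a character of the
    torus can be read off from its values at 2. *)
Lemma exp2z_inj (k : fieldType) : [pchar k] =i pred0 ->
  injective (fun z : int => (2 : k) ^ z).
Proof.
move=> /pcharf0P char0 y z /= eq_yz.
have n2 : (2 : k) != 0 by rewrite char0.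
have : (2 : k) ^ (y - z) = 1 by rewrite expfzDr // eq_yz -expfzDr // subrr.
have pow1 (m : nat) : (2 : k) ^ m = 1 -> m = 0%N.
  move/eqP; rewrite -exprnP -natrX -subr_eq0 -(natrB _ (expn_gt0 2 m)) char0.
  by case: m => // m; rewrite expnS; have := expn_gt0 2 m; lia.
move=> E1; suff : y - z = 0 by lia.
case: (intP (y - z)) E1 => // m; first by move/pow1.
move=> E1; have /pow1 : (2 : k) ^ m.+1%:Z = 1 by rewrite -[LHS]invrK invr_expz E1 invr1.
by [].
Qed.

(** With the [u p] as columns of U and the [u' p] as rows of U', duality says U' U = 1 and the
    conclusion says U U' = 1; these agree for square matrices over a commutative ring. *)
Lemma dual_basis_sum (R : comUnitRingType) (m : nat) (I : finType)
    (u : I -> 'cV[R]_m) (u' : I -> 'rV[R]_m) :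
  #|I| = m -> (forall p q, u' p *m u q = (p == q)%:R%:M) ->
  \sum_p u p *m u' p = 1%:M.
Proof.
move=> cardI; case: m / cardI u u' => u u' dual.
pose U : 'M[R]_#|I| := \matrix_(i, j) u (enum_val j) i 0.
pose U' : 'M[R]_#|I| := \matrix_(i, j) u' (enum_val i) 0 j.
have U'U : U' *m U = 1%:M.
  apply/matrixP => i j; rewrite mxE [RHS]mxE -(inj_eq enum_val_inj).
  have /matrixP /(_ 0 0) := dual (enum_val i) (enum_val j).
  rewrite !mxE mulr1n => <-.
  by apply: eq_bigr => l _; rewrite !mxE.
rewrite -(mulmx1C U'U); apply/matrixP => i j; rewrite summxE mxE.
rewrite (reindex (@enum_val I predT)) /=; last by apply: onW_bij; apply: enum_val_bij.
by apply: eq_bigr => l _; rewrite mxE big_ord1 !mxE.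
Qed.

(** * Images of subspaces and extension of scalars *)

Section Act.

Variables (k : fieldType) (m : nat).
Implicit Types (X Y : {vspace 'cV[k]_m}) (M N : 'M[k]_m) (v : 'cV[k]_m).

Lemma mem_act M X v : v \in X -> M *m v \in act M X.
Proof.
move=> vX; have := memv_img (linfun (mulmx M : 'cV[k]_m -> 'cV[k]_m)) vX.
by rewrite lfunE.
Qed.

Lemma actP M X v : reflect (exists2 w, w \in X & v = M *m w) (v \in act M X).
Proof.
apply: (iffP memv_imgP) => -[w wX ->]; exists w => //; by rewrite lfunE.
Qed.

Lemma actM M N X : act (M *m N) X = act M (act N X).
Proof.
apply/vspaceP => v; apply/actP/actP => [[w wX ->]|[_ /actP [w wX ->] ->]].
  by exists (N *m w); rewrite ?mem_act // mulmxA.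
by exists w; rewrite // mulmxA.
Qed.

Lemma act1 X : act 1%:M X = X.
Proof.
apply/vspaceP => v; apply/actP/idP => [[w wX ->]|vX]; first by rewrite mul1mx.
by exists v; rewrite // mul1mx.
Qed.

Lemma act_unitK M X : M \in unitmx -> act (invmx M) (act M X) = X.
Proof. by move=> uM; rewrite -actM mulVmx // act1. Qed.

Lemma act_unitVK M X : M \in unitmx -> act M (act (invmx M) X) = X.
Proof. by move=> uM; rewrite -actM mulmxV // act1. Qed.

Lemma is_span_unique (S : 'cV[k]_m -> Prop) X Y :
  is_span S X -> is_span S Y -> X = Y.
Proof.
case=> SX minX [SY minY]; apply/eqP; rewrite eqEsubv.
by rewrite (minX _ SY) (minY _ SX).
Qed.

Variable A : kalg k.

Lemma extM p q r (B : 'M[k]_(p, q)) (C : 'M[k]_(q, r)) :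
  ext A (B *m C) = ext A B *m ext A C.
Proof. exact: map_mxM. Qed.

Lemma ext1 p : ext A (1%:M : 'M[k]_p) = 1%:M.
Proof. exact: map_mx1. Qed.

Lemma extZ p q c (B : 'M[k]_(p, q)) : ext A (c *: B) = kalg_str A c *: ext A B.
Proof. exact: map_mxZ. Qed.

Lemma ext_sum p q (I : finType) (F : I -> 'M[k]_(p, q)) :
  ext A (\sum_i F i) = \sum_i ext A (F i).
Proof. exact: (raddf_sum (map_mx (kalg_str A))). Qed.

Lemma in_extZ X a (v : 'cV[A]_m) : in_ext X v -> in_ext X (a *: v).
Proof.
case=> c ->; exists (fun i => a * c i); rewrite scaler_sumr.
by apply: eq_bigr => i _; rewrite scalerA.
Qed.

Lemma in_ext_sum X (I : finType) (F : I -> 'cV[A]_m) :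
  (forall i, in_ext X (F i)) -> in_ext X (\sum_i F i).
Proof.
move=> XF; apply: big_ind => // [|v w [c ->] [d ->]].
  by exists (fun=> 0); rewrite big1 // => i _; rewrite scale0r.
exists (fun i => c i + d i); rewrite -big_split.
by apply: eq_bigr => i _; rewrite scalerDl.
Qed.

Lemma in_ext_ext X v : v \in X -> in_ext X (ext A v).
Proof.
move=> vX; rewrite (coord_vbasis vX) ext_sum.
exists (fun i => kalg_str A (coord (vbasis X) i v)).
by apply: eq_bigr => i _; rewrite extZ (tnth_nth 0).
Qed.

Lemma in_ext_act M X (v : 'cV[A]_m) :
  in_ext X v -> in_ext (act M X) (ext A M *m v).
Proof.
case=> c ->; rewrite mulmx_sumr; apply: in_ext_sum => i.
rewrite -scalemxAr -extM; apply/in_extZ/in_ext_ext/mem_act/vbasis_mem/mem_tnth.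
Qed.

Lemma in_ext_act_unit M X (v : 'cV[A]_m) : M \in unitmx ->
  in_ext (act M X) v <-> in_ext X (ext A (invmx M) *m v).
Proof.
move=> uM; split=> [/(in_ext_act (invmx M))|/(in_ext_act M)].
  by rewrite act_unitK.
by rewrite mulmxA -extM mulmxV // ext1 mul1mx.
Qed.

End Act.

(** * Stabilizers and incidence under conjugation *)

Section Stabilizer.

Variables (k : fieldType) (G : gfunctor k) (m : nat) (rho : rep G m).
Implicit Types (X Y : {vspace 'cV[k]_m}).

Lemma ext_base p q (M : 'M[k]_(p, q)) : ext (base k) M = M.
Proof. exact: map_mx_id. Qed.

Lemma in_ext_base X (v : 'cV[k]_m) : @in_ext k (base k) m X v <-> v \in X.
Proof.
split=> [[c ->]|vX]; last by rewrite -(ext_base v); apply: in_ext_ext.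
apply: memv_suml => i _; rewrite ext_base; apply/memvZ/vbasis_mem/mem_tnth.
Qed.

Lemma stabilizer_base X (g : G (base k)) :
  stabilizer rho X g <-> forall v, (v \in X) = (rho (base k) g *m v \in X).
Proof.
split=> st v; last by rewrite !in_ext_base st.
have [h1 h2] := st v; apply/idP/idP => vX; apply/in_ext_base.
  by apply: h1; apply/in_ext_base.
by apply: h2; apply/in_ext_base.
Qed.

Lemma rep_mulVl (A : kalg k) (g : G A) : rho A g^-1%g *m rho A g = 1%:M.
Proof. by rewrite -repM mulVg rep1. Qed.

Lemma rep_mulVr (A : kalg k) (g : G A) : rho A g *m rho A g^-1%g = 1%:M.
Proof. by rewrite -repM mulgV rep1. Qed.

(** The usual conjugation of stabilizers, phrased so that it serves both for [M] = [s] with [h] =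
    [phi A g] and for [M] the matrix of a group element. *)
Lemma stabilizer_act (M : 'M[k]_m) X (A : kalg k) (g h : G A) :
  M \in unitmx -> rho A h = conj_by M (rho A g) ->
  stabilizer rho (act M X) h <-> stabilizer rho X g.
Proof.
move=> uM rho_h; have KM : ext A (invmx M) *m ext A M = 1%:M.
  by rewrite -extM mulVmx // ext1.
split=> st v; last first.
  rewrite !in_ext_act_unit // rho_h /conj_by !mulmxA KM mul1mx -mulmxA.
  exact: st.
have := st (ext A M *m v).
rewrite !in_ext_act_unit // rho_h /conj_by !mulmxA KM !mul1mx -!mulmxA.
by rewrite (mulmxA _ (ext A M)) KM mul1mx.
Qed.

(** If the parabolic [P] witnesses incidence, its image under [phi], written as a preimage under
    [psi], witnesses incidence of the images. *)
Lemma incident_act (M : 'M[k]_m) (phi psi : ghom G G) X Y :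
  M \in unitmx ->
  (forall A, cancel (phi A) (psi A)) -> (forall A, cancel (psi A) (phi A)) ->
  (forall (A : kalg k) (g : G A), rho A (phi A g) = conj_by M (rho A g)) ->
  incident rho X Y -> incident rho (act M X) (act M Y).
Proof.
move=> uM phiK psiK lift [P [parP PX PY]].
have st Z (A : kalg k) (g : G A) :
    stabilizer rho Z (psi A g) -> stabilizer rho (act M Z) g.
  by move=> Zg; apply/(stabilizer_act Z uM (g := psi A g)) => //; rewrite -lift psiK.
exists (preim_sub psi P); split; first exact: (parabolic_preim phiK psiK).
  by move=> A g /PX/st.
by move=> A g /PY/st.
Qed.

End Stabilizer.

(** * Coordinates with respect to the weight basis *)

Section Coordinates.

Variables (k : fieldType) (n : nat) (G : gfunctor k).
Variables (rho : rep G (2 * n)) (b : 'M[k]_(2 * n)).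
Variables (e f : 'I_n -> 'cV[k]_(2 * n)).
Hypothesis b_sym : b^T = b.
Hypothesis b_ef : forall i j, bform b (e i) (f j) = (i == j)%:R.
Hypothesis b_ee : forall i j, bform b (e i) (e j) = 0.
Hypothesis b_ff : forall i j, bform b (f i) (f j) = 0.

Notation I := ('I_n * bool)%type.

Definition wbasis (p : I) : 'cV[k]_(2 * n) := if p.2 then f p.1 else e p.1.

(** The form pairs a basis vector nontrivially only with the one of opposite weight, so pairing with
    the opposite vector gives the dual basis. *)
Definition wdual (p : I) : 'rV[k]_(2 * n) := (wbasis (wt_opp p))^T *m b.

Lemma bformC v w : bform b v w = bform b w v.
Proof.
rewrite /bform -[v^T *m b *m w]trmxK mxE; congr (fun_of_matrix _ 0 0).
by rewrite !trmx_mul trmxK b_sym mulmxA.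
Qed.

Lemma wdual_wbasis p q : wdual p *m wbasis q = (p == q)%:R%:M.
Proof.
rewrite [LHS]mx11_scalar; congr (_%:M); rewrite -[LHS]/(bform b _ _) /wbasis.
case: p q => i [] [j []]; rewrite /= xpair_eqE ?andbT ?andbF ?b_ee ?b_ff //.
by rewrite bformC b_ef eq_sym.
Qed.

Lemma wbasis_sum : \sum_p wbasis p *m wdual p = 1%:M.
Proof.
apply: dual_basis_sum wdual_wbasis.
by rewrite card_prod card_ord card_bool mulnC.
Qed.

Definition wcoord (A : kalg k) (p : I) (v : 'cV[A]_(2 * n)) : A :=
  (ext A (wdual p) *m v) 0 0.

Lemma wcoord_mulmx (A : kalg k) p (v : 'cV[A]_(2 * n)) :
  ext A (wdual p) *m v = (wcoord p v)%:M.
Proof. exact: mx11_scalar. Qed.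

Lemma wcoord_wbasis (A : kalg k) p q :
  wcoord p (ext A (wbasis q)) = (p == q)%:R.
Proof. by rewrite /wcoord -extM wdual_wbasis !mxE mulr1n rmorph_nat. Qed.

Lemma wcoordZ (A : kalg k) p a (v : 'cV[A]_(2 * n)) :
  wcoord p (a *: v) = a * wcoord p v.
Proof. by rewrite /wcoord -scalemxAr mxE. Qed.

Lemma wcoordB (A : kalg k) p (v w : 'cV[A]_(2 * n)) :
  wcoord p (v - w) = wcoord p v - wcoord p w.
Proof. by rewrite /wcoord mulmxBr !mxE. Qed.

Lemma wcoord_sum (A : kalg k) p (J : finType) (F : J -> 'cV[A]_(2 * n)) :
  wcoord p (\sum_i F i) = \sum_i wcoord p (F i).
Proof. by rewrite /wcoord mulmx_sumr summxE. Qed.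

Lemma wcoordK (A : kalg k) (v : 'cV[A]_(2 * n)) :
  v = \sum_p wcoord p v *: ext A (wbasis p).
Proof.
rewrite -[LHS]mul1mx -(ext1 A) -wbasis_sum ext_sum mulmx_suml.
by apply: eq_bigr => p _; rewrite extM -mulmxA wcoord_mulmx mul_mx_scalar.
Qed.

Definition mcoef (A : kalg k) (g : G A) (q p : I) : A :=
  wcoord q (rho A g *m ext A (wbasis p)).

Lemma wcoord_rho (A : kalg k) (g : G A) q v :
  wcoord q (rho A g *m v) = \sum_p mcoef g q p * wcoord p v.
Proof.
rewrite {1}[v]wcoordK mulmx_sumr wcoord_sum.
by apply: eq_bigr => p _; rewrite -scalemxAr wcoordZ mulrC.
Qed.

Lemma rho_wbasis (A : kalg k) (g : G A) p :
  rho A g *m ext A (wbasis p) = \sum_q mcoef g q p *: ext A (wbasis q).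
Proof. exact: wcoordK. Qed.

Lemma mcoefM (A : kalg k) (g h : G A) q p :
  mcoef (g * h)%g q p = \sum_r mcoef g q r * mcoef h r p.
Proof. by rewrite /mcoef repM -mulmxA wcoord_rho. Qed.

Lemma mcoef1 (A : kalg k) q p : mcoef (1%g : G A) q p = (q == p)%:R.
Proof. by rewrite /mcoef rep1 mul1mx wcoord_wbasis. Qed.

Lemma ext_khom (A B : kalg k) (h : khom A B) p q (M : 'M[k]_(p, q)) :
  map_mx h (ext A M) = ext B M.
Proof. by apply/matrixP => i j; rewrite !mxE khom_str. Qed.

Lemma mcoef_gmap (A B : kalg k) (h : khom A B) (g : G A) q p :
  mcoef (gmap G h g) q p = h (mcoef g q p).
Proof.
by rewrite /mcoef /wcoord rep_nat -!(ext_khom h) -!map_mxM mxE.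
Qed.

Lemma eq_form (M : 'M[k]_(2 * n)) :
  (forall p q, bform M (wbasis p) (wbasis q) = bform b (wbasis p) (wbasis q)) ->
  M = b.
Proof.
move=> eqM; have E (N : 'M[k]_(2 * n)) : N =
    \sum_p \sum_q (wdual p)^T *m (bform N (wbasis p) (wbasis q))%:M *m wdual q.
  rewrite -[LHS]mulmx1 -[LHS]mul1mx -{1}trmx1 -!wbasis_sum linear_sum /= mulmx_suml.
  apply: eq_bigr => p _; rewrite mulmxA mulmx_sumr; apply: eq_bigr => q _.
  by rewrite /bform -mx11_scalar trmx_mul !mulmxA.
rewrite (E M) (E b); apply: eq_bigr => p _; apply: eq_bigr => q _.
by rewrite eqM.
Qed.

(** * Spans of weight vectors *)

Definition wspan (J : pred I) : {vspace 'cV[k]_(2 * n)} :=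
  (\sum_(p | J p) <[wbasis p]>)%VS.

Lemma wcoord_wbasis_base p q : @wcoord (base k) p (wbasis q) = (p == q)%:R.
Proof. by rewrite -(wcoord_wbasis (base k)) ext_base. Qed.

Lemma wcoordK_base (v : 'cV[k]_(2 * n)) :
  v = \sum_p @wcoord (base k) p v *: wbasis p.
Proof. by rewrite {1}(@wcoordK (base k) v); apply: eq_bigr => p _; rewrite ext_base. Qed.

Lemma wbasis_wspan (J : pred I) p : J p -> wbasis p \in wspan J.
Proof.
by move=> Jp; apply: (subvP (sumv_sup p Jp (subvv _))); apply: memv_line.
Qed.

Lemma wspanP (J : pred I) (v : 'cV[k]_(2 * n)) :
  v \in wspan J <-> forall p, ~~ J p -> @wcoord (base k) p v = 0.
Proof.
split=> [/memv_sumP [w wJ ->] p nJp|v0].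
  rewrite /wcoord mulmx_sumr summxE big1 // => q Jq.
  have /vlineP [c ->] := wJ q Jq; rewrite -scalemxAr mxE -/(wcoord _ _).
  rewrite wcoord_wbasis_base; case: (p =P q) nJp => [->|_]; first by rewrite Jq.
  by rewrite mulr0.
rewrite [v]wcoordK_base; apply: memv_suml => p _.
case: (boolP (J p)) => [Jp|/v0 ->]; last by rewrite scale0r mem0v.
exact/memvZ/wbasis_wspan.
Qed.

(** Preservation of the span of [J], expressed by vanishing matrix coefficients so that it is
    visibly closed; the condition on the inverse makes it a subgroup over every algebra. *)
Definition coef_stable (J : pred I) : subfunctor G := fun A g =>
  forall p q, J p -> ~~ J q -> mcoef g q p = 0 /\ mcoef (g^-1)%g q p = 0.

Lemma coef_stable_closed J : closed_subgroup (coef_stable J).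
Proof.
have mulJ (A : kalg k) (g h : G A) :
    (forall p q, J p -> ~~ J q -> mcoef g q p = 0) ->
    (forall p q, J p -> ~~ J q -> mcoef h q p = 0) ->
    forall p q, J p -> ~~ J q -> mcoef (g * h)%g q p = 0.
  move=> gJ hJ p q Jp Jq; rewrite mcoefM big1 // => r _.
  case: (boolP (J r)) => [Jr|nJr]; first by rewrite gJ ?mul0r.
  by rewrite hJ ?mulr0.
split.
  exists (fun F => exists p q, [/\ J p, ~~ J q &
     (F = fun A (g : G A) => mcoef g q p) \/
     (F = fun A (g : G A) => mcoef (g^-1)%g q p)]); split.
    move=> F [p [q [_ _ [] ->]]] A B h g; rewrite -mcoef_gmap //.
    by rewrite gmapV.
  move=> A g; split=> [gJ F [p [q [Jp Jq [] ->]]]|gJ p q Jp Jq].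
  - by have [] := gJ p q Jp Jq.
  - by have [] := gJ p q Jp Jq.
  split; first by apply: (gJ (fun A (g : G A) => mcoef g q p)); exists p, q; split; auto.
  by apply: (gJ (fun A (g : G A) => mcoef (g^-1)%g q p)); exists p, q; split; auto.
move=> A; split.
- move=> p q Jp Jq; rewrite invg1 mcoef1; case: eqP Jq => // ->; by rewrite Jp.
- move=> g h gJ hJ p q Jp Jq; rewrite invgM.
  by split; apply: mulJ => // p0 q0 Jp0 Jq0;
    case: (gJ p0 q0 Jp0 Jq0); case: (hJ p0 q0 Jp0 Jq0).
- by move=> g gJ p q Jp Jq; rewrite invgK; have [] := gJ p q Jp Jq.
Qed.

Lemma coef_stable_wspan (J : pred I) (g : G (base k)) v :
  (forall p q, J p -> ~~ J q -> mcoef g q p = 0) ->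
  v \in wspan J -> rho (base k) g *m v \in wspan J.
Proof.
move=> gJ /wspanP vJ; apply/wspanP => q Jq.
rewrite wcoord_rho big1 // => p _.
case: (boolP (J p)) => [Jp|/vJ ->]; last by rewrite mulr0.
by rewrite gJ ?mul0r.
Qed.

Lemma wspan_isotropic (J : pred I) v w : (forall p, J p -> ~~ J (wt_opp p)) ->
  v \in wspan J -> w \in wspan J -> bform b v w = 0.
Proof.
move=> Jopp /wspanP vJ /wspanP wJ; rewrite [v]wcoordK_base.
rewrite /bform linear_sum /= !mulmx_suml summxE big1 // => p _.
rewrite linearZ /= -!scalemxAl mxE.
case: (boolP (J p)) => [Jp|/vJ ->]; last by rewrite mul0r.
have := wJ _ (Jopp p Jp); rewrite /wcoord ext_base /wdual wt_oppK => ->.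
by rewrite mulr0.
Qed.

(** * The map s as an isometric involution *)

Variable s : 'M[k]_(2 * n).
Hypothesis s_fix : forall i : 'I_n, (i.+1 < n)%N -> s *m e i = e i /\ s *m f i = f i.
Hypothesis s_swap : forall i : 'I_n, i.+1 = n -> s *m e i = f i /\ s *m f i = e i.

Lemma s_wbasis p : s *m wbasis p = wbasis (wt_flip p).
Proof.
case: p => i a; rewrite /wbasis /wt_flip /=; case: (i.+1 =P n) => i1.
  by have [se sf] := s_swap i1; case: a.
have [|se sf] := @s_fix i; first by have := ltn_ord i; lia.
by case: a.
Qed.

Lemma s_invol : s *m s = 1%:M.
Proof.
rewrite -[LHS]mulmx1 -wbasis_sum mulmx_sumr.
by apply: eq_bigr => p _; rewrite mulmxA -(mulmxA s s) !s_wbasis wt_flipK.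
Qed.

(** [s] permutes the weight basis by [wt_flip], which commutes with passing to the opposite weight,
    so the Gram matrix is unchanged. *)
Lemma s_isometry : s^T *m b *m s = b.
Proof.
apply: eq_form => p q.
have E p' q' : bform b (wbasis p') (wbasis q') = (wt_opp p' == q')%:R.
  have := wdual_wbasis (wt_opp p') q'.
  rewrite /wdual wt_oppK /bform => ->; by rewrite mxE mulr1n.
transitivity (bform b (s *m wbasis p) (s *m wbasis q)).
  by rewrite /bform trmx_mul !mulmxA.
rewrite !s_wbasis !E -wt_flip_opp (inj_eq (can_inj (@wt_flipK n))) //.
Qed.

Hypothesis s_GL : s \in unitmx.

Lemma invmx_s : invmx s = s.
Proof. by rewrite -[LHS]mulmx1 -s_invol mulmxA mulVmx // mul1mx. Qed.

Lemma SO_conj_s (A : kalg k) (M : 'M[A]_(2 * n)) : SO b M <-> SO b (conj_by s M).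
Proof.
have ss : ext A s *m ext A s = 1%:M by rewrite -extM s_invol ext1.
have sb : (ext A s)^T *m ext A b *m ext A s = ext A b.
  have -> : (ext A s)^T = ext A s^T by apply/matrixP => i j; rewrite !mxE.
  by rewrite -!extM s_isometry.
have imp (N : 'M[A]_(2 * n)) : SO b N -> SO b (conj_by s N).
  case=> Nb N1; rewrite /conj_by invmx_s; split.
    transitivity ((ext A s)^T *m
        (N^T *m ((ext A s)^T *m ext A b *m ext A s) *m N) *m ext A s).
      by rewrite !trmx_mul !mulmxA.
    by rewrite sb Nb.
  by rewrite !det_mulmx N1 mulr1 -det_mulmx ss det1.
split; first exact: imp.
move/imp; congr (SO b _); rewrite /conj_by invmx_s !mulmxA ss mul1mx.
by rewrite -mulmxA ss mulmx1.
Qed.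

Lemma act_sK X : act s (act s X) = X.
Proof. by rewrite -actM s_invol act1. Qed.

End Coordinates.

(** * The action of the root subgroups *)

(** The algebra k[X] carries the generic root element x_r(X), from which every x_r(u) is obtained by
    evaluation, thanks to naturality. *)
Definition poly_kalg (k : fieldType) : kalg k :=
  KAlg (polyC : {rmorphism k -> {poly k}}).

Section PolyEval.

Variables (k : fieldType) (A : kalg k) (u : A).

Definition poly_eval_fun : {rmorphism poly_kalg k -> A} :=
  (horner_eval u \o map_poly (kalg_str A) : {rmorphism {poly k} -> A}).

Lemma poly_eval_str c : poly_eval_fun (kalg_str (poly_kalg k) c) = kalg_str A c.
Proof. by rewrite /poly_eval_fun /= map_polyC /horner_eval hornerC. Qed.

Definition poly_eval : khom (poly_kalg k) A :=
  @KHom k (poly_kalg k) A poly_eval_fun poly_eval_str.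

Lemma poly_evalE p : poly_eval p = (map_poly (kalg_str A) p).[u].
Proof. by []. Qed.

Lemma poly_evalX : poly_eval ('X : {poly k}) = u.
Proof. by rewrite poly_evalE map_polyX hornerX. Qed.

End PolyEval.

Lemma coef_poly_eval_scale (k : fieldType) (c : k) (p : {poly k}) j :
  (poly_eval (c *: 'X : poly_kalg k) p)`_j = c ^+ j * p`_j.
Proof.
rewrite poly_evalE -[_.[_]]/(p \Po (c *: 'X)) comp_polyE coef_sum.
under eq_bigr do rewrite exprZn scalerA coefZ coefXn.
case: (ltnP j (size p)) => [lt_j|le_j].
  rewrite (bigD1 (Ordinal lt_j)) //= eqxx mulr1 mulrC big1 ?addr0 // => i.
  by rewrite -val_eqE eq_sym /= => /negPf ->; rewrite mulr0.
rewrite [p`_j]nth_default // mulr0 big1 // => i _.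
by case: eqP => [ji|]; rewrite ?mulr0 //; have := ltn_ord i; rewrite -ji ltnNge le_j.
Qed.

Section RootAction.

Variables (k : fieldType) (n : nat) (G : gfunctor k) (x : root_maps n G).
Arguments x : clear implicits.
Hypothesis char0 : [pchar k] =i pred0.
Hypothesis n_ge4 : (4 <= n)%N.
Hypothesis G_split : split_simply_connected_D x.
Variables (rho : rep G (2 * n)) (b : 'M[k]_(2 * n)).
Variables (e f : 'I_n -> 'cV[k]_(2 * n)).
Hypothesis b_sym : b^T = b.
Hypothesis b_ef : forall i j, bform b (e i) (f j) = (i == j)%:R.
Hypothesis b_ee : forall i j, bform b (e i) (e j) = 0.
Hypothesis b_ff : forall i j, bform b (f i) (f j) = 0.
Hypothesis e_weight : forall i, e i != 0 /\ weight_vector x rho (eps i) (e i).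
Hypothesis f_weight : forall i, f i != 0 /\ weight_vector x rho (- eps i) (f i).

Notation I := ('I_n * bool)%type.
Notation sroot := (@simple_root n).
Notation bv := (wbasis e f).
Notation mc := (mcoef rho b e f).
Notation cB := (@wcoord k n b e f (base k)).
Notation Kx := (poly_kalg k).

Let two_neq0 : (2 : k) != 0.
Proof. by have /pcharf0P -> := char0. Qed.

Let wcoordE := wcoord_wbasis b_sym b_ef b_ee b_ff.

(** As 2 has infinite order, these points of the torus already distinguish all weights. *)
Definition torus2 (A : kalg k) (i : 'I_n) : G A :=
  coroot x (sroot i) (kalg_str A 2).

Lemma torus2_wbasis (A : kalg k) i p :
  rho A (torus2 A i) *m ext A (bv p)
  = kalg_str A (2 ^ dot (wt p) (sroot i)) *: ext A (bv p).
Proof.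
have u2 : (2 : k) \is a GRing.unit by rewrite unitfE.
have uA : kalg_str A 2 \is a GRing.unit by apply: rmorph_unit.
rewrite rmorphXz // /wt /wbasis; case: p => j [] /=; rewrite -eps_unit_vec //.
  by case: (f_weight j) => _; apply.
by case: (e_weight j) => _; apply.
Qed.

Lemma wt_separated p w :
  (forall i, (2 : k) ^ dot (wt p) (sroot i) = 2 ^ dot w (sroot i)) -> wt p = w.
Proof.
move=> eq_pw; apply/eqP; rewrite -subr_eq0; apply/eqP.
apply: (simple_root_separates n_ge4) => i; rewrite dotBl.
by rewrite (exp2z_inj char0 (eq_pw i)) subrr.
Qed.

Lemma torus2_mcoef (A : kalg k) i q p :
  mc (torus2 A i) q p = kalg_str A (2 ^ dot (wt p) (sroot i)) * (q == p)%:R.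
Proof. by rewrite /mcoef torus2_wbasis wcoordZ wcoordE. Qed.

Definition root_poly (r : 'rV[int]_n) (q p : I) : {poly k} :=
  mc (x r (Kx) 'X) q p.

Lemma mcoef_root_eval r (A : kalg k) (u : A) q p : is_root r ->
  mc (x r A u) q p = poly_eval u (root_poly r q p).
Proof.
move=> r_root; rewrite /root_poly -mcoef_gmap (ssc_nat G_split) //.
by rewrite poly_evalX.
Qed.

(* Conjugation by the torus scales the argument of x_r, so each monomial of a
   matrix coefficient is a weight vector for the torus. *)
Lemma root_poly_weight r q p j : is_root r ->
  (root_poly r q p)`_j != 0 -> wt q = wt p + r *+ j.
Proof.
move=> r_root nz; apply: wt_separated => i.
have u2 : (2 : k) \is a GRing.unit by rewrite unitfE.
have uA : kalg_str Kx 2 \is a GRing.unit by apply: rmorph_unit.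
set c : k := 2 ^ dot r (sroot i).
have conj : (torus2 Kx i * x r Kx 'X = x r Kx (c *: 'X : {poly k}) * torus2 Kx i)%g.
  have := ssc_corootJ G_split (is_root_simple_root n_ge4 i) r_root (A := Kx) 'X uA.
  rewrite -/(torus2 Kx i) -rmorphXz // mul_polyC => <-.
  by rewrite mulgVK.
have := congr1 (fun g => mc g q p) conj.
rewrite /= !(mcoefM rho b_sym b_ef b_ee b_ff).
rewrite (bigD1 q) //= big1 => [|s /negPf ns]; last first.
  by rewrite torus2_mcoef eq_sym ns mulr0 mul0r.
rewrite (bigD1 p) //= big1 => [|s /negPf ns]; last first.
  by rewrite torus2_mcoef ns !mulr0.
rewrite !addr0 !torus2_mcoef !eqxx !mulr1 -/(root_poly r q p).
rewrite (mcoef_root_eval _ q p r_root).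
(* Comparing coefficients of X^j gives 2^(wt q, alpha_i) = c^j 2^(wt p, alpha_i) after cancelling
   the nonzero coefficient. *)
move/(congr1 (fun h : {poly k} => h`_j)).
rewrite /= coefCM coefMC coef_poly_eval_scale mulrAC => /(mulIf nz) ->.
rewrite dotDl dotMnl expfzDr // mulrC; congr (_ * _).
by rewrite /c exprnP exprz_exp [dot _ _ *+ j]pmulrn mulrzz.
Qed.

(** The matrix entry of the operator E_r, the derivative of x_r(u) at 0. *)
Definition root_coef (r : 'rV[int]_n) (q p : I) : k := (root_poly r q p)`_1.

Lemma root_coef_weight r q p : is_root r ->
  root_coef r q p != 0 -> wt q = wt p + r.
Proof. by move=> r_root /(root_poly_weight r_root); rewrite mulr1n. Qed.

Lemma root_map0 r (A : kalg k) : is_root r -> x r A 0 = 1%g.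
Proof.
move=> r_root; apply: (@mulgI _ (x r A 0)).
by rewrite -(ssc_add G_split) // addr0 mulg1.
Qed.

(** The constant term is the identity because x_r(0) = 1, and a term of degree at least 2 would
    require two weights differing by a multiple of [r] excluded by [wt_root_string]. *)
Lemma mcoef_root r (A : kalg k) (u : A) q p : is_root r ->
  mc (x r A u) q p = (q == p)%:R + kalg_str A (root_coef r q p) * u.
Proof.
move=> r_root; rewrite mcoef_root_eval //.
have -> : root_poly r q p = (q == p)%:R%:P + (root_coef r q p) *: 'X.
  apply/polyP => -[|[|j]];
    rewrite coefD coefC coefZ coefX /= ?mulr0 ?mulr1 ?addr0 ?add0r //.
    have := mcoef_root_eval (0 : base k) q p r_root.
    rewrite root_map0 // mcoef1 // poly_evalE => ->.
    by rewrite horner_coef0 coef_map.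
  apply/eqP; apply: contraT => /(root_poly_weight r_root) eq_q.
  by have := wt_root_string r_root eq_q.
rewrite poly_evalE rmorphD /= map_polyZ map_polyX map_polyC hornerD hornerC.
by rewrite hornerZ hornerX; congr (_ + _); exact: (rmorph_nat (kalg_str A)).
Qed.

Lemma root_mapV r (A : kalg k) (u : A) : is_root r -> (x r A u)^-1%g = x r A (- u).
Proof.
move=> r_root; apply: (@mulgI _ (x r A u)).
by rewrite mulgV -(ssc_add G_split) // subrr root_map0.
Qed.

(** The indexed weights are distinct, so E_r sends [bv p] to a multiple of [bv q] alone, and it has
    no diagonal entry since [r] is nonzero. *)
Lemma rho_root_wbasis r p q (u : base k) : is_root r -> wt q = wt p + r ->
  rho (base k) (x r (base k) u) *m bv p = bv p + (root_coef r q p * u) *: bv q.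
Proof.
move=> r_root eq_q; rewrite -{1}(ext_base (bv p)) (rho_wbasis rho b_sym b_ef b_ee b_ff).
have npq : p != q.
  apply/eqP => pq; move: eq_q; rewrite -pq => /eqP.
  rewrite -subr_eq0 opprD addrA subrr add0r oppr_eq0 => /eqP r0.
  by move: r_root; rewrite /is_root r0 dot0l.
rewrite (bigD1 p) //= (bigD1 q) 1?eq_sym //= big1 ?addr0 => [|s /andP [/negPf sp sq]].
  rewrite !mcoef_root // !ext_base eqxx (eq_sym q) (negPf npq) add0r; congr (_ + _).
  have [->|/(root_coef_weight r_root) eq_p] := eqVneq (root_coef r p p) 0.
    by rewrite rmorph0 mul0r addr0 scale1r.
  by move: npq; rewrite -(inj_eq (@wt_inj _)) eq_q -eq_p eqxx.
rewrite mcoef_root // sp add0r.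
have [->|/(root_coef_weight r_root) eq_s] := eqVneq (root_coef r s p) 0.
  by rewrite rmorph0 mul0r scale0r.
by move: sq; rewrite -(inj_eq (@wt_inj _)) eq_q -eq_s eqxx.
Qed.

Let rho_wbasisE := rho_wbasis rho b_sym b_ef b_ee b_ff.
Let cB_wbasis p q : cB p (bv q) = (p == q)%:R :=
  wcoord_wbasis_base b_sym b_ef b_ee b_ff p q.

Lemma wbasis_neq0 p : bv p != 0.
Proof.
apply/eqP => p0; have := cB_wbasis p p; rewrite p0 /wcoord mulmx0 mxE eqxx.
by move/eqP; rewrite eq_sym oner_eq0.
Qed.

Lemma rho_root_fix r p (u : base k) : is_root r ->
  (forall q, root_coef r q p = 0) -> rho (base k) (x r (base k) u) *m bv p = bv p.
Proof.
move=> r_root c0; rewrite -{1}(ext_base (bv p)) rho_wbasisE (bigD1 p) //= big1.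
  by rewrite mcoef_root // c0 rmorph0 mul0r eqxx !addr0 ext_base scale1r.
by move=> q /negPf qp; rewrite mcoef_root // c0 qp rmorph0 mul0r addr0 scale0r.
Qed.

(* Otherwise both x_r and x_(-r) fix the weight vector, hence so does the
   coroot, which acts on it by a nontrivial character. *)
Lemma root_coef_simple_neq0 r i p q :
  r = sroot i \/ r = - sroot i -> wt q = wt p + r -> root_coef r q p != 0.
Proof.
move=> r_i eq_q; have i_root := is_root_simple_root n_ge4 i.
have r_root : is_root r by case: r_i => ->; rewrite // ; apply: is_rootN.
have pr := dot_wt_root r_root eq_q.
apply/eqP => c0.
have cr s : root_coef r s p = 0.
  apply/eqP; apply: contraT => nz; have eq_s := root_coef_weight r_root nz.
  by move: nz; rewrite -eq_q in eq_s; rewrite (wt_inj eq_s) c0 eqxx.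
(* The weights [wt p + r] and [wt p - r] cannot both occur: the pairing of [wt p] with [r] would be
   both -1 and 1. *)
have cNr s : root_coef (- r) s p = 0.
  apply/eqP; apply: contraT => nz.
  have := dot_wt_root (is_rootN r_root) (root_coef_weight (is_rootN r_root) nz).
  by rewrite dotC dotNl dotC pr.
pose fx (g : G (base k)) := rho (base k) g *m bv p = bv p.
have fxM g h : fx g -> fx h -> fx (g * h)%g.
  by rewrite /fx repM -mulmxA => gp ->.
have fxV g : fx g -> fx (g^-1)%g.
  by rewrite /fx => {1}<-; rewrite mulmxA rep_mulVl mul1mx.
have fxr u : fx (x r (base k) u) by apply: rho_root_fix.
have fxNr u : fx (x (- r) (base k) u) by apply: rho_root_fix => //; apply: is_rootN.
have [fxi fxNi] : (forall u, fx (x (sroot i) (base k) u)) /\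
                  (forall u, fx (x (- sroot i) (base k) u)).
  by case: r_i fxr fxNr => ->; rewrite ?opprK.
have fxw t : fx (root_w x (sroot i) (t : base k)).
  by apply: (fxM); [apply: (fxM)|].
have : fx (torus2 (base k) i) by apply: (fxM) => //; apply: (fxV).
rewrite /fx; have := torus2_wbasis (base k) i p; rewrite ext_base => -> /eqP.
rewrite -subr_eq0 -{2}[bv p]scale1r -scalerBl scaler_eq0 (negPf (wbasis_neq0 p)) orbF.
rewrite subr_eq0 -(expr0z (2 : k)) => /eqP/(exp2z_inj char0) d0.
by case: r_i pr => ->; rewrite dotC ?dotNl dotC d0 => /eqP.
Qed.

Lemma wcoord_torus2 i q (v : 'cV[k]_(2 * n)) :
  cB q (rho (base k) (torus2 (base k) i) *m v) = 2 ^ dot (wt q) (sroot i) * cB q v.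
Proof.
rewrite (wcoord_rho rho b_sym b_ef b_ee b_ff) (bigD1 q) //= big1.
  by rewrite torus2_mcoef eqxx mulr1 addr0.
by move=> p /negPf pq; rewrite torus2_mcoef eq_sym pq mulr0 mul0r.
Qed.

(* The unwanted weight components are removed one at a time by the operators
   h_i(2) - 2 ^ <wt q, alpha_i>. *)
Lemma wbasis_mem_torus2_stable (X : {vspace 'cV[k]_(2 * n)}) v p :
  (forall i w, w \in X -> rho (base k) (torus2 (base k) i) *m w \in X) ->
  v \in X -> cB p v != 0 -> bv p \in X.
Proof.
move=> stX vX vp.
have [w [wX wp w0]] : exists w, [/\ w \in X, cB p w != 0 &
    forall q, q \in enum {: I} -> q != p -> cB q w = 0].
  elim: (enum {: I}) => [|q s [w [wX wp ws]]]; first by exists v; split.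
  have [->|qp] := eqVneq q p.
    by exists w; split=> // q'; rewrite inE => /orP [/eqP -> /eqP|/ws].
  have [i ni] : exists i, (2 : k) ^ dot (wt p) (sroot i) != 2 ^ dot (wt q) (sroot i).
    apply/existsP; rewrite -negb_forall; apply: contraNN qp => /forallP eq_pq.
    apply/eqP/wt_inj; symmetry; apply: wt_separated => i; exact/eqP.
  exists (rho (base k) (torus2 (base k) i) *m w - (2 ^ dot (wt q) (sroot i) : k) *: w).
  have E q' : cB q' (rho (base k) (torus2 (base k) i) *m w
        - (2 ^ dot (wt q) (sroot i) : k) *: w)
      = (2 ^ dot (wt q') (sroot i) - 2 ^ dot (wt q) (sroot i)) * cB q' w.
    rewrite (@wcoordB k n b e f (base k)) wcoord_torus2.
    by rewrite (@wcoordZ k n b e f (base k)) mulrBl.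
  split; first by apply: rpredB; [apply: stX|apply: rpredZ].
    by rewrite E mulf_neq0 // subr_eq0.
  move=> q'; rewrite inE E => /orP [/eqP ->|q's q'p]; first by rewrite subrr mul0r.
  by rewrite ws // mulr0.
suff E : w = cB p w *: bv p.
  by rewrite -[bv p]scale1r -(mulVf wp) -scalerA rpredZ // -E.
rewrite [LHS](wcoordK_base b_sym b_ef b_ee b_ff) (bigD1 p) //= big1 ?addr0 // => q qp.
by rewrite w0 ?mem_enum // scale0r.
Qed.

(** * The standard subspaces and their stabilizers *)

Notation Wd d := (wspan e f (topwt d)).

(** Adding [r] never leaves the set of top weights, so all matrix entries leading out of it
    vanish. *)
Lemma root_coef_stable d r (A : kalg k) (u : A) :
  is_root r -> 0 <= dot r (fweight d) ->
  coef_stable rho b e f (topwt d) (x r A u).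
Proof.
move=> r_root r_ge0 p q p_d q_d; rewrite root_mapV // !mcoef_root //.
have -> : (q == p) = false by apply/negP => /eqP qp; rewrite qp p_d in q_d.
have -> : root_coef r q p = 0.
  apply/eqP; apply: contraT => /(root_coef_weight r_root) eq_q.
  by rewrite (topwt_raise r_ge0 eq_q p_d) in q_d.
by rewrite (rmorph0 (kalg_str A)) !mul0r addr0.
Qed.

Lemma stabilizer_root d r (u : k) : is_root r -> 0 <= dot r (fweight d) ->
  stabilizer rho (Wd d) (x r (base k) u).
Proof.
move=> r_root r_ge0.
have st w v : v \in Wd d -> rho (base k) (x r (base k) w) *m v \in Wd d.
  apply: (coef_stable_wspan b_sym b_ef b_ee b_ff) => p q p_d q_d.
  by have [] := @root_coef_stable d r (base k) w r_root r_ge0 p q p_d q_d.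
apply/stabilizer_base => v; apply/idP/idP => [|/(st (- u))]; first exact: st.
by rewrite mulmxA -root_mapV // rep_mulVl mul1mx.
Qed.

Lemma stabilizer_torus2 d i : stabilizer rho (Wd d) (torus2 (base k) i).
Proof.
apply/stabilizer_base => v.
apply/idP/idP => /(wspanP b_sym b_ef b_ee b_ff) v0; apply/(wspanP b_sym b_ef b_ee b_ff).
  by move=> p /v0 vp; rewrite wcoord_torus2 vp mulr0.
move=> p /v0; rewrite wcoord_torus2 => /eqP; rewrite mulf_eq0 expfz_eq0.
by rewrite (negPf two_neq0) andbF => /eqP.
Qed.

(** Stability under the torus points makes [X] a span of weight vectors. Its weights are closed
    under the simple root shifts available in the stabilizer and contain no opposite pair, so
    [topwt_unique] identifies them. *)
Lemma stabilizer_isotropic_unique d (X : {vspace 'cV[k]_(2 * n)}) :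
  X != 0%VS -> (forall v w, v \in X -> w \in X -> bform b v w = 0) ->
  (forall g v, stabilizer rho (Wd d) g -> v \in X -> rho (base k) g *m v \in X) ->
  X = Wd d.
Proof.
move=> X0 isoX stX.
have torX i w : w \in X -> rho (base k) (torus2 (base k) i) *m w \in X.
  by apply: stX; apply: stabilizer_torus2.
have rootX r i p q : (r = sroot i \/ r = - sroot i) ->
    0 <= dot r (fweight d) -> wt q = wt p + r -> bv p \in X -> bv q \in X.
  move=> r_i r_ge0 eq_q pX; have c0 := root_coef_simple_neq0 r_i eq_q.
  have r_root : is_root r.
    by case: r_i => ->; [|apply: is_rootN]; apply: is_root_simple_root.
  have := stX _ _ (@stabilizer_root d r 1 r_root r_ge0) pX.
  (* Subtracting [bv p] from its image and dividing by the nonzero coefficient isolates [bv q]. *)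
  rewrite (rho_root_wbasis _ r_root eq_q) mulr1 => /(rpredB) -/(_ _ pX).
  rewrite addrAC subrr add0r => /(rpredZ (root_coef r q p)^-1).
  by rewrite scalerA mulVf // scale1r.
have Xp : forall p, bv p \in X <-> topwt d p.
  apply: (topwt_unique n_ge4).
  - move=> j p q; apply: (rootX _ j); first by left.
    by have [] := dot_simple_root_fweight n_ge4 d j.
  - move=> j p q jd; apply: (rootX _ j); first by right.
    have [_ /(_ jd)] := dot_simple_root_fweight n_ge4 d j.
    by rewrite dotNl => ->.
  - move=> p pX p'X; have := isoX _ _ p'X pX.
    have := wdual_wbasis b_sym b_ef b_ee b_ff p p.
    move/(congr1 (fun M : 'M_1 => M 0 0)); rewrite -[LHS]/(bform b _ _) => -> /eqP.
    by rewrite eqxx mxE eqxx mulr1n oner_eq0.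
  have v0 := memv_pick X; have : vpick X != 0 by rewrite vpick0.
  move: (vpick X) v0 => v vX nv.
  have [p vp] : exists p, cB p v != 0.
    apply/existsP; rewrite -negb_forall; apply: contraNN nv => /forallP v0.
    rewrite [v](wcoordK_base b_sym b_ef b_ee b_ff) big1 // => p _.
    by have /eqP -> := v0 p; rewrite scale0r.
  by exists p; apply: wbasis_mem_torus2_stable vX vp.
apply/vspaceP => v; apply/idP/idP => [vX|vW].
  apply/(wspanP b_sym b_ef b_ee b_ff) => p; apply: contraNeq => vp.
  exact/Xp/(wbasis_mem_torus2_stable _ vX).
rewrite [v](wcoordK_base b_sym b_ef b_ee b_ff); apply: rpred_sum => p _.
case: (boolP (topwt d p)) => [/Xp pX|np]; first exact: rpredZ.
have /(wspanP b_sym b_ef b_ee b_ff) -> // := vW; by rewrite scale0r rpred0.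
Qed.

(** * Objects of the geometry *)

Variable vplus : 'cV[k]_(2 * n).
Hypothesis vplus_hw : highest_weight_vector x rho (omega1 n) vplus.

(** The weight omega_1 = eps_1 occurs only once in the basis, so all other coordinates of [vplus]
    vanish. *)
Lemma vplus_line (i : 'I_n) : i = 0%N :> nat ->
  exists2 c, c != 0 & vplus = c *: bv (i, false).
Proof.
move=> i0; have [nv wv _] := vplus_hw.
have eq_v p : cB p vplus != 0 -> p = (i, false).
  move=> vp; apply: wt_inj; rewrite [RHS]/wt /= i0; apply: wt_separated => j.
  apply: (mulIf vp); rewrite -wcoord_torus2.
  have u2 : (2 : k) \is a GRing.unit by rewrite unitfE.
  have := wv (base k) 2 u2 j; rewrite !ext_base => /(congr1 (cB p)).
  by rewrite (@wcoordZ k n b e f (base k)).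
have E : vplus = cB (i, false) vplus *: bv (i, false).
  rewrite [LHS](wcoordK_base b_sym b_ef b_ee b_ff) (bigD1 (i, false)) //= big1 ?addr0 //.
  move=> p np; have [->|/eq_v pi] := eqVneq (cB p vplus) 0; first exact: scale0r.
  by rewrite pi eqxx in np.
exists (cB (i, false) vplus) => //.
by apply: contraNneq nv => c0; rewrite E c0 scale0r.
Qed.

Lemma levi1 d (A : kalg k) : levi x d (1%g : G A).
Proof. by move=> S [_ subS] _; have [] := subS A. Qed.

Lemma leviM d (A : kalg k) (g h : G A) :
  levi x d g -> levi x d h -> levi x d (g * h)%g.
Proof.
move=> Lg Lh S clS ES; have [_ /(_ A) [_ SM _]] := clS.
by apply: SM; [apply: Lg|apply: Lh].
Qed.

Lemma levi_root d r (A : kalg k) (u : A) :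
  is_component_root d r -> levi x d (x r A u).
Proof. by move=> r_d S _; apply; exists r; split => //; exists u. Qed.

(** Component roots pair to 0 with [fweight d], so the Levi subgroup lies in the closed subgroup
    preserving [Wd d]. Conversely, the elements x_(-alpha_j)(1) of the Levi subgroup produce all top
    weight vectors from the highest one. *)
Lemma levi_span (d : 'I_n) : d != 0%N :> nat ->
  is_span (fun w => exists2 g : G (base k), levi x d g & w = rho (base k) g *m vplus)
    (Wd d).
Proof.
move=> d0; have n0 : (0 < n)%N by apply: leq_trans n_ge4.
have [c c0 v_e] := @vplus_line (Ordinal n0) (erefl _).
split=> [_ [g Lg ->]|W' SW'].
  apply: (coef_stable_wspan b_sym b_ef b_ee b_ff).
    move=> p q p_d q_d; suff [] : mc g q p = 0 /\ mc (g^-1)%g q p = 0 by [].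
    move: p q p_d q_d; apply: (Lg (coef_stable rho b e f (topwt d))).
      exact: (coef_stable_closed rho b_sym b_ef b_ee b_ff).
    move=> A h [r [r_d [u ->]]]; apply: root_coef_stable; first by case: r_d.
    by rewrite component_root_fweight.
  rewrite v_e; apply/rpredZ/wbasis_wspan; rewrite topwtE /=.
  by case: eqP => //; lia.
(* Quantifying over all Levi translates lets the induction absorb x_(-alpha_j)(1) into [g], as [W']
   itself is not assumed stable. *)
pose Q p := forall g : G (base k), levi x d g -> rho (base k) g *m bv p \in W'.
suff QW p : topwt d p -> Q p.
  apply/subv_sumP => p p_d; rewrite -memvE -[bv p]mul1mx -(rep1 rho (base k)).
  exact: (QW p p_d _ (@levi1 d (base k))).
apply: (topwt_min n_ge4) => {p} [i i0 g Lg|_ j p q jd eq_q Qp g Lg].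
  have -> : i = Ordinal n0 by apply: val_inj.
  rewrite -[bv _]scale1r -(mulVf c0) -scalerA -v_e -scalemxAr rpredZ //.
  by apply: SW'; exists g.
have j_root : is_root (- sroot j) by apply/is_rootN/is_root_simple_root.
have cq : root_coef (- sroot j) q p != 0 by apply: (@root_coef_simple_neq0 _ j); [right|].
have Lj := @levi_root d _ (base k) 1 (in_component_simple_root n_ge4 d0 jd).
have := Qp _ (leviM Lg Lj).
rewrite repM -mulmxA (rho_root_wbasis _ j_root eq_q) mulr1 mulmxDr -scalemxAr.
move=> /(rpredB) /(_ (Qp g Lg)); rewrite addrC addKr.
by move/(rpredZ (root_coef (- sroot j) q p)^-1); rewrite scalerA mulVf // scale1r.
Qed.

Lemma is_VdeltaE d W : is_Vdelta x rho vplus d W <-> W = Wd d.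
Proof.
rewrite /is_Vdelta; case: eqP => [d0|/eqP d0]; last first.
  split=> [spW|->]; last exact: levi_span.
  exact: (is_span_unique spW (levi_span d0)).
have [c c0 ->] := vplus_line d0.
suff -> : Wd d = <[c *: bv (d, false)]>%VS by [].
have -> : Wd d = <[bv (d, false)]>%VS.
  rewrite /wspan (eq_bigl (pred1 (d, false))) ?big_pred1_eq // => -[i a] /=.
  rewrite topwtE /= d0 ifN; last by lia.
  by rewrite leqn0 -{1}d0 xpair_eqE; case: a; rewrite ?andbF.
apply/eqP; rewrite eqEsubv -!memvE rpredZ ?memv_line // andbT.
by rewrite -{1}[bv _]scale1r -(mulVf c0) -scalerA rpredZ ?memv_line.
Qed.

Lemma has_typeE X d : has_type x rho vplus X d <->
  exists g : G (base k), X = act (rho (base k) g) (Wd d).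
Proof.
split=> [[g [W [/is_VdeltaE -> ->]]]|[g ->]]; exists g => //.
by exists (Wd d); split=> //; apply/is_VdeltaE.
Qed.

(** * Objects are determined by their stabilizers *)

Hypothesis b_inv : invariant_form rho b.

Lemma rho_unitmx (g : G (base k)) : rho (base k) g \in unitmx.
Proof. by have /mulmx1_unit [] := rep_mulVr rho g. Qed.

Lemma rho_invmx (g : G (base k)) : invmx (rho (base k) g) = rho (base k) (g^-1)%g.
Proof.
by rewrite -[LHS]mulmx1 -(rep_mulVr rho g) mulmxA mulVmx ?rho_unitmx // mul1mx.
Qed.

Lemma bform_rho (g : G (base k)) v w :
  bform b (rho (base k) g *m v) (rho (base k) g *m w) = bform b v w.
Proof.
have := b_inv g; rewrite ext_base /bform trmx_mul => E.
by rewrite -!mulmxA (mulmxA b) (mulmxA _^T (b *m _)) (mulmxA _^T b) E.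
Qed.

Lemma Wd_isotropic d v w : v \in Wd d -> w \in Wd d -> bform b v w = 0.
Proof.
apply: (wspan_isotropic b_sym b_ef b_ee b_ff) => p; exact: topwt_opp.
Qed.

Lemma Wd_neq0 d : Wd d != 0%VS.
Proof.
have n0 : (0 < n)%N by apply: leq_trans n_ge4.
apply: contraNneq (wbasis_neq0 (Ordinal n0, false)) => W0.
have : bv (Ordinal n0, false) \in Wd d.
  by apply: wbasis_wspan; rewrite topwtE /=; case: eqP => //; lia.
by rewrite W0 memv0.
Qed.

Lemma act_neq0 (M : 'M[k]_(2 * n)) (X : {vspace 'cV[k]_(2 * n)}) :
  M \in unitmx -> X != 0%VS -> act M X != 0%VS.
Proof.
move=> uM; apply: contraNneq => /(congr1 (act (invmx M))).
by rewrite act_unitK // => ->; rewrite /act limg0.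
Qed.

(** After translating [X] back to [Wd d], the translate of [Y] is nonzero, isotropic by invariance
    of the form, and stable under the stabilizer of [Wd d]; hence it equals [Wd d]. *)
Lemma object_stabilizer_inj X Y :
  is_object x rho vplus X -> is_object x rho vplus Y ->
  sub_eq (stabilizer rho X) (stabilizer rho Y) -> X = Y.
Proof.
move=> [d /has_typeE [g ->]] [d' /has_typeE [h ->]] {X Y} eqst.
set Y := act _ (Wd d') in eqst *.
pose Z := act (invmx (rho (base k) g)) Y.
have YZ : Y = act (rho (base k) g) Z by rewrite /Z act_unitVK ?rho_unitmx.
suff ZW : Z = Wd d by rewrite YZ ZW.
apply: stabilizer_isotropic_unique.
- rewrite /Z rho_invmx; apply: act_neq0; first exact: rho_unitmx.
  apply: act_neq0; [exact: rho_unitmx|exact: Wd_neq0].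
- rewrite /Z rho_invmx => v0 w0 /actP [v' /actP [v v_W ->] ->].
  move=> /actP [w' /actP [w w_W ->] ->].
  by rewrite !bform_rho; apply: Wd_isotropic v_W w_W.
move=> a v sta vZ.
have conj : rho (base k) (g * a * g^-1)%g = conj_by (rho (base k) g) (rho (base k) a).
  by rewrite !repM /conj_by !ext_base rho_invmx.
have /eqst := proj2 (stabilizer_act (Wd d) (rho_unitmx g) conj) sta.
rewrite YZ => /(proj1 (stabilizer_act Z (rho_unitmx g) conj)) /stabilizer_base <-.
exact: vZ.
Qed.

(** * The action of s on the geometry *)

Variable s : 'M[k]_(2 * n).
Hypothesis s_GL : s \in unitmx.
Hypothesis s_fix : forall i : 'I_n, (i.+1 < n)%N -> s *m e i = e i /\ s *m f i = f i.
Hypothesis s_swap : forall i : 'I_n, i.+1 = n -> s *m e i = f i /\ s *m f i = e i.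

Let s_wbasisE := s_wbasis s_fix s_swap.
Let s_involE := s_invol b_sym b_ef b_ee b_ff s_fix s_swap.
Let s_inv := invmx_s b_sym b_ef b_ee b_ff s_fix s_swap s_GL.
Let s_actK := act_sK b_sym b_ef b_ee b_ff s_fix s_swap.

(** One inclusion follows on basis vectors from [topwt_flip]; applying it to [type_swap d] and then
    [s], an involution, gives the other. *)
Lemma act_s_Wd d : act s (Wd d) = Wd (type_swap d).
Proof.
have sub d' : (act s (Wd d') <= Wd (type_swap d'))%VS.
  apply/subvP => _ /actP [v /memv_sumP [w wW ->] ->].
  rewrite mulmx_sumr; apply: rpred_sum => p p_d; have /vlineP [c ->] := wW p p_d.
  by rewrite -scalemxAr s_wbasisE rpredZ // wbasis_wspan // topwt_flip.
apply/eqP; rewrite eqEsubv sub /=.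
have := limgS (linfun (mulmx s : 'cV[k]_(2 * n) -> 'cV[k]_(2 * n))) (sub (type_swap d)).
by rewrite type_swapK // -/(act s _) -/(act s _) s_actK.
Qed.

Variable phi : ghom G G.
Hypothesis phi_aut : gautomorphism phi.
Hypothesis phi_lift : forall (A : kalg k) (g : G A),
  rho A (phi A g) = conj_by s (rho A g).

(** By the lifting property, s rho(g) V_d = rho(phi(g)) s V_d, and s V_d is again a standard
    subspace. *)
Lemma has_type_act_s X d :
  has_type x rho vplus X d -> has_type x rho vplus (act s X) (type_swap d).
Proof.
move/has_typeE => [g ->]; apply/has_typeE; exists (phi (base k) g).
rewrite phi_lift /conj_by !ext_base s_inv -act_s_Wd -!actM.
by rewrite -!mulmxA s_involE mulmx1.
Qed.

Lemma geometry_automorphism_s : geometry_automorphism x rho vplus (act s).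
Proof.
have obj X : is_object x rho vplus X -> is_object x rho vplus (act s X).
  by case=> d /has_type_act_s; exists (type_swap d).
have [psi [phiK psiK]] := gautomorphism_inverse phi_aut.
have inc := incident_act s_GL phiK psiK phi_lift.
(* Because [s] is an involution, the inverse of [phi] also lifts conjugation by [s]; this gives the
   converse for incidence. *)
have psi_lift (A : kalg k) (g : G A) : rho A (psi A g) = conj_by s (rho A g).
  have := phi_lift (psi A g); rewrite psiK => ->.
  have ss : ext A s *m ext A s = 1%:M by rewrite -extM s_involE ext1.
  by rewrite /conj_by s_inv !mulmxA ss mul1mx -mulmxA ss mulmx1.
have inc' := incident_act s_GL psiK phiK psi_lift.
split=> //.
- by move=> X Y _ _ /(congr1 (act s)); rewrite !s_actK.
- by move=> Y objY; exists (act s Y); rewrite ?s_actK //; apply: obj.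
- by move=> X Y _ _; split; [apply: inc|move/inc'; rewrite !s_actK].
exists (@type_swap n).
  by exists (@type_swap n); apply: type_swapK.
move=> X d _; split; first exact: has_type_act_s.
by move/has_type_act_s; rewrite s_actK type_swapK.
Qed.

(** Conjugation by [s] turns the stabilizer of X into that of sX over every algebra, and
    [object_stabilizer_inj] makes the object with this stabilizer unique. *)
Lemma induced_by_act_s : induced_by x rho vplus phi (act s).
Proof.
have [psi [phiK psiK]] := gautomorphism_inverse phi_aut.
have img X : sub_eq (stabilizer rho (act s X)) (sub_image phi (stabilizer rho X)).
  move=> A g; split=> [stg|[h sth ->]]; last first.
    by apply/(stabilizer_act X s_GL (phi_lift h)).
  exists (psi A g); rewrite ?psiK //.
  by apply/(stabilizer_act X s_GL (phi_lift (psi A g))); rewrite psiK.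
move=> X objX; have [obj _ _ _ _] := geometry_automorphism_s.
split; first exact: obj.
move=> Y objY; split=> [stY|->]; last exact: img.
apply: object_stabilizer_inj => //; first exact: obj.
by move=> A g; rewrite stY -img.
Qed.

End RootAction.

Theorem mainTheorem4
  (k : fieldType) (char0 : [pchar k] =i pred0)
  (n : nat) (n_ge4 : (4 <= n)%N)
  (G : gfunctor k) (x : root_maps n G) (G_split : split_simply_connected_D x)
  (rho : rep G (2 * n)) (rho_irr : irreducible_rep rho)
  (vplus : 'cV[k]_(2 * n))
  (vplus_hw : highest_weight_vector x rho (omega1 n) vplus)
  (b : 'M[k]_(2 * n)) (b_neq0 : b != 0) (b_sym : b^T = b)
  (b_inv : invariant_form rho b)
  (e f : 'I_n -> 'cV[k]_(2 * n))
  (e_weight : forall i, e i != 0 /\ weight_vector x rho (eps i) (e i))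
  (f_weight : forall i, f i != 0 /\ weight_vector x rho (- eps i) (f i))
  (b_ef : forall i j, bform b (e i) (f j) = (i == j)%:R)
  (b_ee : forall i j, bform b (e i) (e j) = 0)
  (b_ff : forall i j, bform b (f i) (f j) = 0)
  (s : 'M[k]_(2 * n)) (s_GL : s \in unitmx)
  (s_fix : forall i : 'I_n, (i.+1 < n)%N -> s *m e i = e i /\ s *m f i = f i)
  (s_swap : forall i : 'I_n, i.+1 = n -> s *m e i = f i /\ s *m f i = e i)
  (phi : ghom G G) (phi_aut : gautomorphism phi)
  (phi_lift : forall (A : kalg k) (g : G A),
     rho A (phi A g) = conj_by s (rho A g)) :
  [/\ forall (A : kalg k) (M : 'M[A]_(2 * n)), SO b M <-> SO b (conj_by s M),
      geometry_automorphism x rho vplus (act s)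
    & induced_by x rho vplus phi (act s)].
Proof.
split.
- exact: (SO_conj_s b_sym b_ef b_ee b_ff s_fix s_swap s_GL).
- exact: (geometry_automorphism_s char0 n_ge4 G_split b_sym b_ef b_ee b_ff
    e_weight f_weight vplus_hw s_GL s_fix s_swap phi_aut phi_lift).
- exact: (induced_by_act_s char0 n_ge4 G_split b_sym b_ef b_ee b_ff
    e_weight f_weight vplus_hw b_inv s_GL s_fix s_swap phi_aut phi_lift).
Qed.
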